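(* Let $u,m\ge2$ be integers, $n=u+m$, let $(\mathbf x_i,y_i)_{i=1}^n$ be a fixed full sample in $\mathcal X\times\mathcal Y$, and let $Z$ be uniform over the $u$-element subsets of $[n]$, $\bar Z=[n]\setminus Z$. Let $K:\mathcal X\times\mathcal X\to\mathbb R$ be a positive definite kernel (non-strict: all finite Gram matrices are positive semidefinite), let $\mu\ge0$, and let $\mathcal F=\mathcal H_{\mathbf X_n}(\mu)$. Let $\ell:\mathbb R\times\mathcal Y\to\mathbb R$ be a loss with $0\le\ell_f(i)\le L_0$ for every $f\in\mathcal F$, $i\in[n]$, where $L_0>0$. Suppose: (a) there is $f_n^*\in\mathcal F$ with $\mathcal L_n(\ell_{f_n^*})=\inf_{f\in\mathcal F}\mathcal L_n(\ell_f)$; (b) there is $L\ge0$ with $|\ell(a,y)-\ell(b,y)|\le L|a-b|$ for all $a,b\in\mathbb R$, $y\in\mathcal Y$; (c) there is $B'>0$ with $T_n(f-f_n^* )\le B'\mathcal L_n(\ell_f-\ell_{f_n^*})$ for every $f\in\mathcal F$. Fix $K_0>1$. Let $\hat\lambda_1\ge\dots\ge\hat\lambda_n\ge0$ be the eigenvalues of $\mathbf K/n$, where $\mathbf K_{ij}=K(\mathbf x_i,\mathbf x_j)$, and for $Q\in\{0,\dots,n\}$ define $$r(u,m,Q)=Q\Big(\frac1u+\frac1m\Big)+\sqrt{\frac{\sum_{q=Q+1}^n\hat\lambda_q}{u}}+\sqrt{\frac{\sum_{q=Q+1}^n\hat\lambda_q}{m}}.$$ Then for every split the minimizers $\hat f_m\in\arg\min_{f\in\mathcal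 F}\mathcal L_m(\ell_f)$ and $\hat f_u\in\arg\min_{f\in\mathcal F}\mathcal L_u(\ell_f)$ exist, and there is a positive constant $c_5$, depending only on $K_0,B',L_0,L,\mu$, such that, for any measurable selections of them and every $x>0$, with probability at least $1-3\exp(-x)$ over $Z$, $$\mathcal E(\hat f_m)\le c_5\Big(\min_{Q\in\{0,\dots,n\}}r(u,m,Q)+\frac{x}{N_{u,m}}\Big).$$
   Context: $[n]=\{1,\dots,n\}$, $N_{u,m}=\min\{u,m\}$, $\mathcal X\subseteq\mathbb R^d$, $\mathcal Y\subseteq\mathbb R$. $\mathcal H_K$ is the reproducing kernel Hilbert space of $K$, $\mathcal H_{\mathbf X_n}=\mathrm{Span}\{K(\cdot,\mathbf x_i):i\in[n]\}\subseteq\mathcal H_K$, and $\mathcal H_{\mathbf X_n}(\mu)=\{f\in\mathcal H_{\mathbf X_n}:\|f\|_{\mathcal H_K}\le\mu\}$. $\ell_f(i)=\ell(f(\mathbf x_i),y_i)$. For $h:[n]\to\mathbb R$: $\mathcal L_n(h)=n^{-1}\sum_{i=1}^nh(i)$, $\mathcal L_m(h)=m^{-1}\sum_{i\in\bar Z}h(i)$ (training), $\mathcal L_u(h)=u^{-1}\sum_{i\in Z}h(i)$ (test), $T_n(h)=n^{-1}\sum_{i=1}^nh(i)^2$; a function $f$ on $\mathcal X$ is identified with $i\mapsto f(\mathbf x_i)$ in $T_n(f)$. The excess risk is $\mathcal E(f)=\mathcal L_u(\ell_f)-\mathcal L_u(\ell_{\hat f_u})$. An empty sum is zero. ''Depending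 only on'' means $c_5$ is a function of the listed parameters alone. *)

(* Defs.v *)
From mathcomp Require Import all_boot all_order all_algebra.
From mathcomp Require Import boolp classical_sets reals sequences.

Set Implicit Arguments.
Unset Strict Implicit.
Unset Printing Implicit Defensive.

Import Order.TTheory GRing.Theory Num.Theory.
Local Open Scope classical_set_scope.
Local Open Scope ring_scope.

Definition psd_mx (R : realType) (n : nat) (A : 'M[R]_n) : Prop :=
  A^T = A /\ forall v : 'rV[R]_n, 0 <= (v *m A *m v^T) 0 0.

Definition gram (R : realType) (X : Type) (K : X -> X -> R) (n : nat)
    (x : 'I_n -> X) : 'M[R]_n := \matrix_(i, j) K (x i) (x j).

Definition pd_kernel (R : realType) (X : Type) (K : X -> X -> R) : Prop :=
  forall (k : nat) (z : 'I_k -> X), psd_mx (gram K z).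

(* The reproducing kernel Hilbert space of K: a real Hilbert space of functions
   on X that contains every section K(., x) and satisfies f x = <f, K(., x)>.
   The inner product is a total operation on functions, constrained only on
   the carrier; these axioms determine the carrier, and the inner product on
   the carrier, from K. *)
Record rkhs (R : realType) (X : Type) (K : X -> X -> R) := Rkhs {
  rkhs_carrier : set (X -> R) ;
  rkhs_dot : (X -> R) -> (X -> R) -> R ;
  rkhs_zero : rkhs_carrier (fun=> 0) ;
  rkhs_comb : forall (a : R) (f g : X -> R),
    rkhs_carrier f -> rkhs_carrier g ->
    rkhs_carrier (fun t => a * f t + g t) ;
  rkhs_dotC : forall f g, rkhs_carrier f -> rkhs_carrier g ->
    rkhs_dot f g = rkhs_dot g f ;
  rkhs_dot_linear : forall (a : R) (f g h : X -> R),
    rkhs_carrier f -> rkhs_carrier g -> rkhs_carrier h ->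
    rkhs_dot (fun t => a * f t + g t) h = a * rkhs_dot f h + rkhs_dot g h ;
  rkhs_dot_ge0 : forall f, rkhs_carrier f -> 0 <= rkhs_dot f f ;
  rkhs_dot_eq0 : forall f, rkhs_carrier f -> rkhs_dot f f = 0 ->
    f = (fun=> 0) ;
  rkhs_complete : forall F : nat -> X -> R,
    let dist f g := Num.sqrt (rkhs_dot (f \- g) (f \- g)) in
    (forall k, rkhs_carrier (F k)) ->
    (forall e : R, 0 < e -> exists N : nat, forall i j : nat,
       (N <= i)%N -> (N <= j)%N -> dist (F i) (F j) < e) ->
    exists2 g, rkhs_carrier g &
      forall e : R, 0 < e -> exists N : nat, forall k : nat,
        (N <= k)%N -> dist (F k) g < e ;
  rkhs_section : forall x : X, rkhs_carrier (fun t => K t x) ;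
  rkhs_reproducing : forall f (x : X), rkhs_carrier f ->
    f x = rkhs_dot f (fun t => K t x)
}.

Definition rkhs_norm (R : realType) (X : Type) (K : X -> X -> R)
    (H : rkhs K) (f : X -> R) : R := Num.sqrt (rkhs_dot H f f).

Definition kernel_span (R : realType) (X : Type) (K : X -> X -> R) (n : nat)
    (x : 'I_n -> X) : set (X -> R) :=
  [set f | exists a : 'I_n -> R, f = (fun t => \sum_(i < n) a i * K t (x i))].

Definition kernel_ball (R : realType) (X : Type) (K : X -> X -> R)
    (H : rkhs K) (n : nat) (x : 'I_n -> X) (mu : R) : set (X -> R) :=
  [set f | kernel_span K x f /\ rkhs_norm H f <= mu].

Definition loss_of (R : realType) (X Y : Type) (ell : R -> Y -> R) (n : nat)
    (x : 'I_n -> X) (y : 'I_n -> Y) (f : X -> R) : 'I_n -> R :=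
  fun i => ell (f (x i)) (y i).

Definition Lfull (R : realType) (n : nat) (h : 'I_n -> R) : R :=
  n%:R^-1 * \sum_(i < n) h i.

Definition Ltrain (R : realType) (u m : nat) (Z : {set 'I_(u + m)})
    (h : 'I_(u + m) -> R) : R := m%:R^-1 * \sum_(i in ~: Z) h i.

Definition Ltest (R : realType) (u m : nat) (Z : {set 'I_(u + m)})
    (h : 'I_(u + m) -> R) : R := u%:R^-1 * \sum_(i in Z) h i.

Definition Tfull (R : realType) (n : nat) (h : 'I_n -> R) : R :=
  n%:R^-1 * \sum_(i < n) h i ^+ 2.

Definition is_argmin (R : realType) (T : Type) (F : set T) (J : T -> R)
    (f : T) : Prop := F f /\ forall g, F g -> J f <= J g.

Definition prob_unif (R : realType) (n u : nat) (E : pred {set 'I_n}) : R :=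
  #|[set Z : {set 'I_n} | (#|Z| == u) && E Z]|%:R
  / #|[set Z : {set 'I_n} | #|Z| == u]|%:R.

(* lam lists the eigenvalues of A with algebraic multiplicity, in
   nonincreasing order. *)
Definition sorted_eigenvalues (R : realType) (n : nat) (A : 'M[R]_n)
    (lam : 'I_n -> R) : Prop :=
  char_poly A = \prod_(i < n) ('X - (lam i)%:P)
  /\ forall i j : 'I_n, (i <= j)%N -> lam j <= lam i.

(* lam is indexed from 0, so the range Q < q <= n of the tail
   becomes Q <= q < n. *)
Definition rate (R : realType) (u m : nat) (lam : 'I_(u + m) -> R) (Q : nat)
    : R :=
  let tail := \sum_(q < u + m | (Q <= q)%N) lam q in
  Q%:R * (u%:R^-1 + m%:R^-1) + Num.sqrt (tail / u%:R)
  + Num.sqrt (tail / m%:R).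

Definition min_rate (R : realType) (u m : nat) (lam : 'I_(u + m) -> R) : R :=
  \big[Num.min/rate lam 0]_(Q < (u + m).+1) rate lam Q.

Definition excess_risk (R : realType) (X Y : Type) (ell : R -> Y -> R)
    (u m : nat) (x : 'I_(u + m) -> X) (y : 'I_(u + m) -> Y)
    (Z : {set 'I_(u + m)}) (fu f : X -> R) : R :=
  Ltest Z (loss_of ell x y f) - Ltest Z (loss_of ell x y fu).

(* Main.v *)
Require Import Defs.
From mathcomp Require Import all_boot all_order all_algebra.
From mathcomp Require Import boolp classical_sets reals sequences.
From mathcomp Require Import exp topology normedtype derive.
From mathcomp Require Import ring lra zify.

Set Implicit Arguments.
Unset Strict Implicit.
Unset Printing Implicit Defensive.

Import Order.TTheory GRing.Theory Num.Theory.
Local Open Scope classical_set_scope.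
Local Open Scope ring_scope.

(** Write f0 for the minimizer in (a), g_f for the loss of f minus the loss of f0, and P, P_W
    for the averages over [n] and over a sample W. Assumption (c) bounds T_n(f - f0) by
    B' P g_f, so it suffices to show that, uniformly over f and with probability 1 - exp(-x),
      P g_f - P_W g_f <= al (rho + T_n(f - f0)),   rho of the order of r(u,m,Q) + x/N,
    for W the training set, and for W the test set with both signs. Only the finitely many
    functions f0, f_m(Z), f_u(Z) matter, so all suprema are finite maxima.

    Rescaling g_f by rho / (rho + T_n(f - f0)) gives a bounded class of variance O(rho), to
    which a Talagrand-type exponential moment bound applies. It is obtained by passing to
    sampling with replacement (Hoeffding), symmetrizing, and using twice an
    infimum-convolution inequality on product spaces: once for the Rademacher signs at fixed
    sample points, and once for the sample points, where the conditional Rademacher complexity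
    plus the conditional variance is self-bounding. The expected complexity is localized by
    the penalty T_n(f - f0), contracted to the linear class, and estimated by Cauchy-Schwarz
    on the eigenvectors of index > Q and by the inequality 2ab <= a^2 + b^2 on the others. *)

(** * Averages and maxima over finite types *)

(** On an empty type this is 0, by the convention for division by 0; lemmas that need an inhabited
    type take an element [t0]. *)
Definition avg (R : realType) (T : finType) (F : T -> R) : R :=
  (\sum_t F t) / #|T|%:R.

(** The argument [t0] makes the type inhabited. Since [fmax t0 F] is literally the value of [F] at a
    maximizer, it inherits every uniform bound on [F]. *)
Definition fmax (R : realType) (T : finType) (t0 : T) (F : T -> R) : R :=
  F [arg max_(t > t0) F t]%O.

Section Avg.
Context {R : realType}.
Implicit Types T A B : finType.

Lemma eq_avg T (F G : T -> R) : F =1 G -> avg F = avg G.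
Proof. by move=> e; congr (_ / _); apply: eq_bigr. Qed.

Lemma le_avg T (F G : T -> R) : (forall t, F t <= G t) -> avg F <= avg G.
Proof. by move=> h; rewrite ler_wpM2r ?invr_ge0 // ler_sum. Qed.

Lemma avg_ge0 T (F : T -> R) : (forall t, 0 <= F t) -> 0 <= avg F.
Proof. by move=> h; rewrite divr_ge0 // sumr_ge0. Qed.

Lemma avg_gt0 T (t0 : T) (F : T -> R) : (forall t, 0 < F t) -> 0 < avg F.
Proof.
move=> h; rewrite divr_gt0 //; last first.
  by rewrite ltr0n; apply/card_gt0P; exists t0.
rewrite (bigD1 t0) //= ltr_pwDl // sumr_ge0 // => t _; exact: ltW.
Qed.

Lemma avg_cst T (t0 : T) (c : R) : avg (fun _ : T => c) = c.
Proof.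
rewrite /avg sumr_const -[c *+ _]mulr_natr mulfK // pnatr_eq0 -lt0n.
by apply/card_gt0P; exists t0.
Qed.

Lemma avgD T (F G : T -> R) : avg (fun t => F t + G t) = avg F + avg G.
Proof. by rewrite /avg big_split mulrDl. Qed.

Lemma avgB T (F G : T -> R) : avg (fun t => F t - G t) = avg F - avg G.
Proof. by rewrite /avg sumrB mulrBl. Qed.

Lemma avgZ T (c : R) (F : T -> R) : avg (fun t => c * F t) = c * avg F.
Proof. by rewrite /avg -mulr_sumr mulrA. Qed.

Lemma avgZr T (c : R) (F : T -> R) : avg (fun t => F t * c) = avg F * c.
Proof. by rewrite /avg -mulr_suml mulrAC. Qed.

Lemma avg_sum T (I : finType) (P : pred I) (F : I -> T -> R) :
  avg (fun t => \sum_(i | P i) F i t) = \sum_(i | P i) avg (F i).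
Proof. by rewrite /avg exchange_big mulr_suml. Qed.

Lemma exchange_avg A B (F : A -> B -> R) :
  avg (fun a => avg (F a)) = avg (fun b => avg (F^~ b)).
Proof. by rewrite /avg -!mulr_suml exchange_big /= mulrAC. Qed.

Lemma avg_pair A B (F : A * B -> R) :
  avg F = avg (fun a => avg (fun b => F (a, b))).
Proof.
rewrite /avg -mulr_suml pair_bigA /= card_prod natrM -mulrA.
rewrite invfM [X in _ * X]mulrC; congr (_ * _).
by apply: eq_bigr => -[].
Qed.

Lemma avg_bij A B (f : A -> B) (g : B -> A) (F : B -> R) :
  cancel f g -> cancel g f -> avg F = avg (fun a => F (f a)).
Proof.
move=> fK gK; rewrite /avg (bij_eq_card (Bijective fK gK)).
by congr (_ / _); rewrite (reindex f) //; exists g => x _.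
Qed.

Lemma avg_bool (F : bool -> R) : avg F = (F true + F false) / 2.
Proof. by rewrite /avg card_bool big_bool. Qed.

Lemma le_of_eq (a b : R) : a = b -> a <= b.
Proof. by move->. Qed.

(** Convexity of the exponential in tangent form: it gives Jensen's inequality, the subgradient of
    an exponential of a maximum, and a weighted AM-GM inequality. *)
Lemma expR_tangent (m z : R) : expR m * (1 + (z - m)) <= expR z.
Proof.
have -> : expR z = expR m * expR (z - m) by rewrite -expRD; congr expR; ring.
by rewrite ler_pM2l ?expR_gt0 // expR_ge1Dx.
Qed.

Lemma expR_avg T (t0 : T) (F : T -> R) : expR (avg F) <= avg (fun t => expR (F t)).
Proof.
apply: (@le_trans _ _ (avg (fun t => expR (avg F) * (1 + (F t - avg F))))).
  by rewrite avgZ avgD avgB !(avg_cst t0) subrr addr0 mulr1.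
by apply: le_avg => t; exact: expR_tangent.
Qed.

(** The variance of [sqrt F] is nonnegative. *)
Lemma sqrt_avg T (t0 : T) (F : T -> R) : (forall t, 0 <= F t) ->
  avg (fun t => Num.sqrt (F t)) <= Num.sqrt (avg F).
Proof.
move=> F0; set m := avg _.
have m0 : 0 <= m by apply: avg_ge0 => t; exact: sqrtr_ge0.
have : m ^+ 2 <= avg F.
  have : 0 <= avg (fun t => (Num.sqrt (F t) - m) ^+ 2).
    by apply: avg_ge0 => t; exact: sqr_ge0.
  under eq_avg => t do rewrite sqrrB sqr_sqrtr //.
  rewrite avgD avgB (avg_cst t0).
  under [X in _ - X]eq_avg => t do rewrite -mulr_natr.
  by rewrite !avgZr -/m => h; nra.
by move=> h; rewrite -(ger0_norm m0) -sqrtr_sqr ler_wsqrtr.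
Qed.

Lemma fmax_ge T (t0 : T) (F : T -> R) t : F t <= fmax t0 F.
Proof. by rewrite /fmax; case: arg_maxP => // i _; exact. Qed.

Lemma fmax_le T (t0 : T) (F : T -> R) c : (forall t, F t <= c) -> fmax t0 F <= c.
Proof. exact. Qed.

Lemma le_fmax T (t0 : T) (F G : T -> R) :
  (forall t, F t <= G t) -> fmax t0 F <= fmax t0 G.
Proof. by move=> h; apply: fmax_le => t; rewrite (le_trans (h t)) // fmax_ge. Qed.

Lemma eq_fmax T (t0 : T) (F G : T -> R) : F =1 G -> fmax t0 F = fmax t0 G.
Proof. by move=> h; apply/eqP; rewrite eq_le !le_fmax // => t; rewrite h. Qed.

Lemma fmaxZ T (t0 : T) (c : R) (F : T -> R) : 0 <= c ->
  fmax t0 (fun t => c * F t) = c * fmax t0 F.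
Proof.
move=> c0; apply/eqP; rewrite eq_le; apply/andP; split.
  by apply: fmax_le => t; rewrite ler_wpM2l // fmax_ge.
exact: (fmax_ge t0 (fun t => c * F t)).
Qed.

Definition fcons (A : Type) N (a : A) (x : {ffun 'I_N -> A}) : {ffun 'I_N.+1 -> A} :=
  [ffun i => if unlift ord0 i is Some j then x j else a].

Lemma fcons0 (A : Type) N (a : A) (x : {ffun 'I_N -> A}) : fcons a x ord0 = a.
Proof. by rewrite ffunE unlift_none. Qed.

Lemma fconsS (A : Type) N (a : A) (x : {ffun 'I_N -> A}) j :
  fcons a x (lift ord0 j) = x j.
Proof. by rewrite ffunE liftK. Qed.

Lemma avg_fcons A N (F : {ffun 'I_N.+1 -> A} -> R) :
  avg F = avg (fun a => avg (fun x => F (fcons a x))).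
Proof.
rewrite -(avg_pair (fun p => F (fcons p.1 p.2))).
pose g (z : {ffun 'I_N.+1 -> A}) := (z ord0, [ffun j => z (lift ord0 j)]).
apply: (@avg_bij _ _ _ g).
  by case=> a x; rewrite /g fcons0; congr (_, _); apply/ffunP => j; rewrite ffunE fconsS.
move=> z; apply/ffunP => i; rewrite ffunE.
by case: unliftP => [j ->|->] //=; rewrite ffunE.
Qed.

Lemma avg_ffun0 A (F : {ffun 'I_0 -> A} -> R) (x0 : {ffun 'I_0 -> A}) : avg F = F x0.
Proof.
rewrite -[RHS](avg_cst x0); apply: eq_avg => x; congr F.
by apply/ffunP; case.
Qed.

(** Two independent tuples form one tuple of independent pairs; symmetrization thus treats a point
    and its sign as a single coordinate. *)
Lemma avg_ffun_pair A B N (F : {ffun 'I_N -> A} -> {ffun 'I_N -> B} -> R) :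
  avg (fun x => avg (F x)) =
  avg (fun z : {ffun 'I_N -> A * B} => F [ffun j => (z j).1] [ffun j => (z j).2]).
Proof.
rewrite -(avg_pair (fun p => F p.1 p.2)).
apply: (@avg_bij _ _ (fun z : {ffun 'I_N -> A * B} => ([ffun j => (z j).1], [ffun j => (z j).2]))
  (fun p => [ffun j => (p.1 j, p.2 j)])) => [z|[x y]] /=.
  by apply/ffunP => j; rewrite !ffunE; case: (z j).
by congr (_, _); apply/ffunP => j; rewrite !ffunE.
Qed.

End Avg.

(** * Infimum convolution, symmetrization and contraction *)

Section Transport.
Context {R : realType}.
Implicit Types T A B : finType.

Lemma expR_le_inv (z : R) : z < 1 -> expR z <= (1 - z)^-1.
Proof.
move=> z1; rewrite -[z in leLHS]opprK expRN lef_pV2 ?posrE ?expR_gt0 ?subr_gt0 //.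
exact: expR_ge1Dx.
Qed.

(** Here [a] is the log-ratio of two slice averages and [p] an interpolation weight. The exponent is
    minimal at [p = 8 a], which is admissible for small [a]; otherwise [p = 1] leaves the exponent
    1/16. *)
Lemma transport_scalar (a : R) : 0 <= a -> exists p : R, [/\ 0 <= p, p <= 1 &
  expR ((1 - p) * a + p ^+ 2 / 16) <= 2 - expR (- a)].
Proof.
move=> a0.
have hN : expR (- a) <= (1 + a)^-1.
  by rewrite -[a in leRHS]opprK; apply: expR_le_inv; lra.
have [a8|a8] := leP a (1 / 8).
  exists (8 * a); split; [lra|lra|].
  have -> : (1 - 8 * a) * a + (8 * a) ^+ 2 / 16 = a - 4 * a ^+ 2 by field.
  apply: le_trans (lerB (lexx 2) hN).
  apply: (le_trans (expR_le_inv _)); first by nra.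
  have -> : 2 - (1 + a)^-1 = (1 + 2 * a) / (1 + a) by field; lra.
  rewrite ler_pdivlMr; last lra.
  rewrite [leLHS]mulrC ler_pdivrMr; last nra.
  rewrite -subr_ge0.
  have -> : (1 + 2 * a) * (1 - (a - 4 * a ^+ 2)) - (1 + a) = 2 * a ^+ 2 + 8 * a ^+ 3 by ring.
  by rewrite addr_ge0 // mulr_ge0 // exprn_ge0.
exists 1; split; [lra|lra|].
apply: le_trans (lerB (lexx 2) hN).
apply: (le_trans (expR_le_inv _)); first by lra.
have : (1 + a)^-1 <= 8 / 9.
  by rewrite -div1r ler_pdivrMr; lra.
have -> : 1 - ((1 - 1) * a + 1 ^+ 2 / 16) = 15 / 16 :> R by field.
by rewrite invf_div; lra.
Qed.

(* An infimum-convolution form of Talagrand's convex distance inequality. *)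
Lemma product_transport A (a0 : A) N (G f : {ffun 'I_N -> A} -> R)
    (al : {ffun 'I_N -> A} -> 'I_N -> R) :
  (forall x y, G x - f y <= \sum_j al x j *+ (x j != y j)) ->
  avg (fun x => expR (G x - 4 * \sum_j al x j ^+ 2))
    * avg (fun x => expR (- f x)) <= 1.
Proof.
elim: N G f al => [|N IH] G f al h.
  pose x0 : {ffun 'I_0 -> A} := [ffun=> a0].
  rewrite !(avg_ffun0 _ x0) big_ord0 -expRD -expR0 ler_expR.
  by have := h x0 x0; rewrite big_ord0; lra.
rewrite !avg_fcons.
pose W a := avg (fun x => expR (- f (fcons a x))).
have x0 : {ffun 'I_N -> A} by exact: [ffun=> a0].
have W0 a : 0 < W a by apply: (avg_gt0 x0) => x; exact: expR_gt0.
(* The reference slice is the one where the average of [expR (- f)] is largest. *)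
pose b := [arg max_(a > a0) W a]%O.
have Wb a : W a <= W b by rewrite /b; case: arg_maxP => // i _; exact.
pose S a x := \sum_j al (fcons a x) (lift ord0 j) ^+ 2.
pose c a x := al (fcons a x) ord0.
have IH1 a : avg (fun x => expR (G (fcons a x) - 4 * S a x)) * W a <= 1.
  apply: (IH (fun x => G (fcons a x)) (fun x => f (fcons a x))
    (fun x j => al (fcons a x) (lift ord0 j))) => x y.
  apply: (le_trans (h _ _)); rewrite big_ord_recl !fcons0 eqxx mulr0n add0r.
  by apply: ler_sum => j _; rewrite !fconsS.
(* Slice [a] is compared with slice [b], and the cost of changing the first coordinate is subtracted
   from [G]. The truncation at 0 bounds that cost whether or not [a] equals [b]. *)
have IH2 a : avg (fun x => expR (G (fcons a x) - Num.max 0 (c a x) - 4 * S a x)) * W b <= 1.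
  apply: (IH (fun x => G (fcons a x) - Num.max 0 (c a x)) (fun x => f (fcons b x))
    (fun x j => al (fcons a x) (lift ord0 j))) => x y.
  rewrite addrAC lerBlDr; apply: (le_trans (h _ _)).
  rewrite big_ord_recl !fcons0 addrC lerD //.
    by apply: ler_sum => j _; rewrite !fconsS.
  rewrite -/(c a x); case: (_ != _) => /=; rewrite ?mulr1n ?mulr0n le_max ?lexx ?orbT //.
(* Interpolate geometrically between [IH1] and [IH2], with the weight given by [transport_scalar] at
   the log-ratio [r]. *)
have step a : avg (fun x => expR (G (fcons a x) - 4 * \sum_j al (fcons a x) j ^+ 2))
    <= (2 - W a / W b) / W b.
  pose r := ln (W b) - ln (W a).
  have r0 : 0 <= r by rewrite subr_ge0 ler_ln ?posrE.
  have er : expR (- r) = W a / W b by rewrite opprB expRB !lnK ?posrE.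
  have [p [p0 p1 hp]] := transport_scalar r0; rewrite er in hp.
  pose D x := (1 - p) * (expR (G (fcons a x) - 4 * S a x) * W a)
    + p * (expR (G (fcons a x) - Num.max 0 (c a x) - 4 * S a x) * W b).
  have avgD_le : avg D <= 1.
    rewrite /D avgD !avgZ !avgZr.
    have := IH1 a; have := IH2 a.
    set u1 := avg _ * _; set u2 := avg _ * _ => h1 h2.
    by nra.
  apply: (@le_trans _ _ (avg (fun x => D x * (expR ((1 - p) * r + p ^+ 2 / 16) / W b)))).
    apply: le_avg => x; rewrite big_ord_recl -/(c a x) -/(S a x).
    set g := G _; set s := S a x; set d := c a x; set d' := Num.max 0 d.
    (* The linear cost of the first coordinate is traded for its quadratic penalty; the remainder
       [p ^+ 2 / 16] is what [transport_scalar] allows. *)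
    have hd : p * d' <= 4 * d ^+ 2 + p ^+ 2 / 16.
      have : 0 <= (2 * d' - p / 4) ^+ 2 by exact: sqr_ge0.
      have : d' ^+ 2 <= d ^+ 2 by rewrite /d'; case: (leP 0 d) => hd; nra.
      by nra.
    have convex : expR ((1 - p) * (g - 4 * s + ln (W a)) + p * (g - d' - 4 * s + ln (W b))) <= D x.
      have eU : expR (g - 4 * s) * W a = expR (g - 4 * s + ln (W a)).
        by rewrite [RHS]expRD lnK ?posrE.
      have eV : expR (g - d' - 4 * s) * W b = expR (g - d' - 4 * s + ln (W b)).
        by rewrite [RHS]expRD lnK ?posrE.
      rewrite /D -/g -/s -/d -/d' eU eV.
      move: (_ + ln (W a)) (_ + ln (W b)) => U V.
      have := expR_tangent ((1 - p) * U + p * V) U.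
      have := expR_tangent ((1 - p) * U + p * V) V.
      set m := _ + _; set E := expR m => hV hU.
      have : (1 - p) * (E * (1 + (U - m))) + p * (E * (1 + (V - m))) <=
          (1 - p) * expR U + p * expR V.
        by apply: lerD; apply: ler_wpM2l => //; rewrite subr_ge0.
      apply: le_trans; apply: le_of_eq.
      by rewrite /m; ring.
    apply: (@le_trans _ _ (expR ((1 - p) * (g - 4 * s + ln (W a)) + p * (g - d' - 4 * s + ln (W b)))
       * (expR ((1 - p) * r + p ^+ 2 / 16) / W b))); last first.
      by apply: ler_wpM2r => //; rewrite divr_ge0 ?expR_ge0 // ltW.
    have -> : (W b)^-1 = expR (- ln (W b)) by rewrite expRN lnK ?posrE.
    by rewrite -!expRD ler_expR /r; nra.
  rewrite avgZr mulrA ler_pM2r ?invr_gt0 //.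
  by apply: (le_trans _ hp); rewrite -[leRHS]mul1r ler_wpM2r ?expR_ge0.
have hW : 0 <= avg W by apply: avg_ge0 => a; exact: ltW.
apply: (@le_trans _ _ (avg (fun a => (2 - W a / W b) / W b) * avg W)).
  by apply: ler_wpM2r => //; exact: le_avg step.
rewrite avgZr avgB avgZr (avg_cst a0).
set w := avg W.
have -> : (2 - w / W b) / W b * w = (2 - w / W b) * (w / W b).
  by rewrite -mulrA [_^-1 * _]mulrC.
(* With [z] the ratio of the mean of [W] to its maximum, the product is [(2 - z) z], at most 1. *)
by move: (w / W b) => z; have := sqr_ge0 (z - 1); nra.
Qed.

(* Replaces the summands of a sum over independent coordinates one at a time. *)
Lemma avg_coordwise A B T N (Psi : (T -> R) -> R) (v : 'I_N -> A -> T -> R)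
    (w : 'I_N -> B -> T -> R) :
  (forall F G, F =1 G -> Psi F = Psi G) ->
  (forall j F, avg (fun a => Psi (fun t => F t + v j a t)) <=
               avg (fun b => Psi (fun t => F t + w j b t))) ->
  forall F, avg (fun x : {ffun 'I_N -> A} => Psi (fun t => F t + \sum_j v j (x j) t)) <=
            avg (fun y : {ffun 'I_N -> B} => Psi (fun t => F t + \sum_j w j (y j) t)).
Proof.
move=> ext; elim: N v w => [|N IH] v w h F.
  have avgE (C : finType) (u : 'I_0 -> C -> T -> R) :
      avg (fun x : {ffun 'I_0 -> C} => Psi (fun t => F t + \sum_j u j (x j) t)) = Psi F.
    have e0 (x : {ffun 'I_0 -> C}) : Psi (fun t => F t + \sum_j u j (x j) t) = Psi F.
      by apply: ext => t; rewrite big_ord0 addr0.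
    have x0 : {ffun 'I_0 -> C} by apply: finfun; case.
    by under eq_avg do rewrite e0; exact: avg_cst x0 _.
  by rewrite !avgE.
rewrite !avg_fcons.
have splitE (C : finType) (u : 'I_N.+1 -> C -> T -> R) a (x : {ffun 'I_N -> C}) :
    Psi (fun t => F t + \sum_j u j (fcons a x j) t) =
    Psi (fun t => (F t + \sum_j u (lift ord0 j) (x j) t) + u ord0 a t).
  apply: ext => t; rewrite big_ord_recl fcons0 addrCA [in RHS]addrC; congr (_ + (_ + _)).
  by apply: eq_bigr => j _; rewrite fconsS.
under eq_avg => a do under eq_avg do rewrite splitE.
under [leRHS]eq_avg => a do under eq_avg do rewrite splitE.
(* Replace the first coordinate with the others frozen, then absorb its summand into [F] and use the
   induction hypothesis. *)
rewrite [leLHS]exchange_avg.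
apply: (@le_trans _ _ (avg (fun x : {ffun 'I_N -> A} => avg (fun b : B =>
   Psi (fun t => F t + \sum_j v (lift ord0 j) (x j) t + w ord0 b t))))).
  by apply: le_avg => x; exact: h.
rewrite [leLHS]exchange_avg; apply: le_avg => b.
have comm (C : finType) (u : 'I_N -> C -> T -> R) :
   (fun x : {ffun 'I_N -> C} => Psi (fun t => F t + \sum_j u j (x j) t + w ord0 b t)) =1
   (fun x : {ffun 'I_N -> C} => Psi (fun t => F t + w ord0 b t + \sum_j u j (x j) t)).
  by move=> x; apply: ext => t; rewrite addrAC.
rewrite (eq_avg (comm _ (fun j => v (lift ord0 j)))) (eq_avg (comm _ (fun j => w (lift ord0 j)))).
exact: (IH (fun j => v (lift ord0 j)) (fun j => w (lift ord0 j)) (fun j => h (lift ord0 j))).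
Qed.

Definition sg (e : bool) : R := (-1) ^+ e.

(* Having a one-coordinate subgradient everywhere gives extensionality and Jensen's
   inequality at once. *)
Definition subdifferentiable T (Psi : (T -> R) -> R) : Prop :=
  forall F, exists t c, forall G, Psi F + c * (G t - F t) <= Psi G.

Lemma fmax_subdiff T (t0 : T) : subdifferentiable (fmax t0).
Proof.
move=> F; exists [arg max_(t > t0) F t]%O, 1 => G.
by rewrite mul1r addrC subrK fmax_ge.
Qed.

Lemma expR_fmax_subdiff T (t0 : T) (l : R) : 0 <= l ->
  subdifferentiable (fun F => expR (l * fmax t0 F)).
Proof.
move=> l0 F; set t := [arg max_(t > t0) F t]%O.
exists t, (expR (l * fmax t0 F) * l) => G.
apply: (@le_trans _ _ (expR (l * G t))); last by rewrite ler_expR ler_wpM2l // fmax_ge.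
apply: le_trans (expR_tangent (l * fmax t0 F) (l * G t)).
apply: le_of_eq; rewrite /fmax -/t; ring.
Qed.

Lemma subdiff_ext T (Psi : (T -> R) -> R) : subdifferentiable Psi ->
  forall F G, F =1 G -> Psi F = Psi G.
Proof.
move=> sub F G FG; apply/eqP; rewrite eq_le; apply/andP; split.
  by have [t [c /(_ G)]] := sub F; rewrite FG subrr mulr0 addr0.
by have [t [c /(_ F)]] := sub G; rewrite FG subrr mulr0 addr0.
Qed.

(** Average the subgradient inequality taken at the mean function: the linear term cancels. *)
Lemma subdiff_convex T (Psi : (T -> R) -> R) A (a0 : A) (F : A -> T -> R) :
  subdifferentiable Psi ->
  Psi (fun t => avg (F^~ t)) <= avg (fun a => Psi (F a)).
Proof.
move=> sub; have [t [c h]] := sub (fun t => avg (F^~ t)).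
apply: le_trans (le_avg (fun a => h (F a))).
by rewrite avgD avgZ avgB !(avg_cst a0) subrr mulr0 addr0.
Qed.

(** Adding a term of mean zero can only raise an expected maximum; this is what allows signed terms
    to be dropped. *)
Lemma fmax_sg T (t0 : T) (F G : T -> R) :
  fmax t0 F <= avg (fun e : bool => fmax t0 (fun t => F t + sg e * G t)).
Proof.
apply: (le_trans _ (subdiff_convex true _ (fmax_subdiff t0))); apply: le_fmax => t.
by rewrite avg_bool /sg expr0 expr1; lra.
Qed.

(** A ghost point stands for the average at each coordinate, and Jensen's inequality moves it
    outside [Psi]. *)
Lemma symmetrization T (Psi : (T -> R) -> R) A (a0 : A) N (q : T -> A -> R) (F : T -> R) :
  subdifferentiable Psi ->
  avg (fun x : {ffun 'I_N -> A} => Psi (fun t => F t + \sum_j (avg (q t) - q t (x j)))) <=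
  avg (fun x : {ffun 'I_N -> A} => avg (fun e : {ffun 'I_N -> bool} =>
    Psi (fun t => F t + \sum_j sg (e j) * (2 * q t (x j))))).
Proof.
move=> sub; have Psi_ext := subdiff_ext sub.
rewrite avg_ffun_pair.
have ext2 : (fun z : {ffun 'I_N -> A * bool} =>
    Psi (fun t => F t + \sum_j sg ([ffun j => (z j).2] j) * (2 * q t ([ffun j => (z j).1] j)))) =1
  (fun z => Psi (fun t => F t + \sum_j sg (z j).2 * (2 * q t (z j).1))).
  by move=> z; apply: Psi_ext => t; congr (_ + _); apply: eq_bigr => j _; rewrite !ffunE.
rewrite (eq_avg ext2) {ext2}.
apply: (avg_coordwise (v := fun=> fun a t => avg (q t) - q t a)
  (w := fun=> fun z t => sg z.2 * (2 * q t z.1)) Psi_ext) => _ {}F.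
rewrite avg_pair /=.
(* A fair coin keeps either the actual point with sign -1 or the ghost point with sign +1; the
   factor 2 offsets the probability 1/2. Each branch then involves one point only, so the pair of
   points collapses to one. *)
apply: (@le_trans _ _ (avg (fun a => avg (fun a' : A => avg (fun e : bool =>
   Psi (fun t => F t + sg e * (2 * q t (if e then a else a')))))))).
  apply: le_avg => a.
  have e1 : (fun t => F t + (avg (q t) - q t a)) =1
      (fun t => avg (fun p : A * bool => F t + sg p.2 * (2 * q t (if p.2 then a else p.1)))).
    move=> t; rewrite avg_pair.
    under [RHS]eq_avg => a' do rewrite avg_bool /= /sg expr0 expr1.
    rewrite avgZr !avgD !avgZ !(avg_cst a0).
    by field.
  rewrite (Psi_ext _ _ e1); apply: (le_trans (subdiff_convex (a0, true) _ sub)).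
  by rewrite avg_pair.
under eq_avg => a do (under eq_avg => a' do rewrite avg_bool /=; rewrite avgZr avgD (avg_cst a0)).
rewrite avgZr avgD (avg_cst a0).
under [leRHS]eq_avg => a do rewrite avg_bool /=.
by rewrite avgZr avgD.
Qed.

(** One sign at a time, the average is half a sum of two maxima. At their maximizers [t] and [t']
    the increment of [g] is dominated by that of [h], after exchanging [t] and [t'] if its sign
    requires it. *)
Lemma rademacher_contraction T (t0 : T) N (F : T -> R) (g h : 'I_N -> T -> R) :
  (forall j t t', `|g j t - g j t'| <= `|h j t - h j t'|) ->
  avg (fun e : {ffun 'I_N -> bool} => fmax t0 (fun t => F t + \sum_j sg (e j) * g j t)) <=
  avg (fun e : {ffun 'I_N -> bool} => fmax t0 (fun t => F t + \sum_j sg (e j) * h j t)).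
Proof.
move=> gh.
apply: (avg_coordwise (v := fun j e t => sg e * g j t) (w := fun j e t => sg e * h j t)
  (@eq_fmax _ _ t0)) => j {}F.
rewrite !avg_bool ler_pM2r ?invr_gt0 // /sg expr0 expr1.
have bound t t' : (F t + -1 * g j t) + (F t' + 1 * g j t') <=
   fmax t0 (fun t => F t + -1 * h j t) + fmax t0 (fun t => F t + 1 * h j t).
  have := gh j t t'.
  have := fmax_ge t0 (fun t => F t + -1 * h j t) t.
  have := fmax_ge t0 (fun t => F t + -1 * h j t) t'.
  have := fmax_ge t0 (fun t => F t + 1 * h j t) t.
  have := fmax_ge t0 (fun t => F t + 1 * h j t) t'.
  by case: (ger0P (h j t - h j t')); case: (ger0P (g j t - g j t')); lra.
exact: bound.
Qed.

End Transport.

(** * Exponential moments for sampling without replacement *)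

Section Concentration.
Context {R : realType}.
Implicit Types T A B : finType.

Lemma normr_sgM e (c : R) : `|sg e * c| = `|c|.
Proof. by rewrite normrM /sg normrX normrN1 expr1n mul1r. Qed.

(** The transport inequality with coefficients taken at the maximizer: the quadratic penalty is at
    most [16 mu^2] times the maximal sum of squares, and Jensen's inequality bounds the other factor
    from below. *)
Lemma rademacher_mgf T (t0 : T) N (c : 'I_N -> T -> R) (mu : R) : 0 <= mu ->
  avg (fun e : {ffun 'I_N -> bool} => expR (mu * fmax t0 (fun t => \sum_j sg (e j) * c j t)))
  <= expR (16 * mu ^+ 2 * fmax t0 (fun t => \sum_j c j t ^+ 2)
       + mu * avg (fun e : {ffun 'I_N -> bool} => fmax t0 (fun t => \sum_j sg (e j) * c j t))).
Proof.
move=> mu0; set V := fmax t0 (fun t => \sum_j c j t ^+ 2).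
pose S (e : {ffun 'I_N -> bool}) := fmax t0 (fun t => \sum_j sg (e j) * c j t).
pose th (e : {ffun 'I_N -> bool}) := [arg max_(t > t0) \sum_j sg (e j) * c j t]%O.
have e0 : {ffun 'I_N -> bool} by exact: [ffun=> true].
(* The maximizer for [x] also competes for [y], and each differing sign costs at most twice the
   coefficient. *)
have lip x y : mu * S x - mu * S y <= \sum_j (2 * mu * `|c j (th x)|) *+ (x j != y j).
  rewrite -mulrBr; apply: (@le_trans _ _
    (mu * \sum_j (sg (x j) * c j (th x) - sg (y j) * c j (th x)))).
    rewrite ler_wpM2l // sumrB lerD2l lerN2.
    exact: (fmax_ge t0 (fun t => \sum_j sg (y j) * c j t)).
  rewrite mulr_sumr; apply: ler_sum => j _.
  have [->|_] := eqVneq (x j) (y j); first by rewrite subrr mulr0.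
  rewrite mulr1n -mulrA [2 * _]mulrC -mulrA ler_wpM2l //.
  apply: (le_trans (ler_norm _)); apply: (le_trans (ler_normB _ _)).
  by rewrite !normr_sgM; lra.
have h := product_transport true lip.
have hV : avg (fun e => expR (mu * S e)) * expR (- (16 * mu ^+ 2 * V)) <=
    avg (fun e => expR (mu * S e - 4 * \sum_j (2 * mu * `|c j (th e)|) ^+ 2)).
  rewrite -avgZr; apply: le_avg => e; rewrite -expRD ler_expR lerD2l lerN2.
  have -> : \sum_j (2 * mu * `|c j (th e)|) ^+ 2 = 4 * mu ^+ 2 * \sum_j c j (th e) ^+ 2.
    rewrite mulr_sumr; apply: eq_bigr => j _.
    by rewrite -[c j _ ^+ 2]real_normK ?num_real //; ring.
  have := fmax_ge t0 (fun t => \sum_j c j t ^+ 2) (th e); rewrite -/V.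
  have := sqr_ge0 mu; nra.
have hM : expR (- (mu * avg S)) <= avg (fun e => expR (- (mu * S e))).
  rewrite -avgZ -mulN1r -avgZ; apply: (le_trans (expR_avg e0 _)).
  by apply: le_avg => e; rewrite mulN1r.
have hh : avg (fun e => expR (mu * S e)) * expR (- (16 * mu ^+ 2 * V)) * expR (- (mu * avg S)) <= 1.
  apply: le_trans h; apply: ler_pM => //; last exact: expR_ge0.
  by rewrite mulr_ge0 ?expR_ge0 //; apply: avg_ge0 => e; exact: expR_ge0.
by move: hh; rewrite -mulrA -expRD -opprD expRN ler_pdivrMr ?expR_gt0 // mul1r.
Qed.

(** Apply the transport inequality to [2 U]: since [16 al <= 1], the penalty [16 sum al^2] is at
    most [sum al <= U], so one copy of [U] survives. *)
Lemma self_bounding_mgf A (a0 : A) N (U : {ffun 'I_N -> A} -> R)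
    (al : {ffun 'I_N -> A} -> 'I_N -> R) :
  (forall x j, 0 <= al x j) -> (forall x j, 16 * al x j <= 1) ->
  (forall x, \sum_j al x j <= U x) ->
  (forall x y, U x - U y <= \sum_j al x j *+ (x j != y j)) ->
  avg (fun x => expR (U x)) <= expR (2 * avg U).
Proof.
move=> al0 al1 alU UU.
have x0 : {ffun 'I_N -> A} by exact: [ffun=> a0].
have lip x y : 2 * U x - 2 * U y <= \sum_j (2 * al x j) *+ (x j != y j).
  rewrite -mulrBr; under eq_bigr do rewrite -mulrnAr.
  by rewrite -mulr_sumr ler_wpM2l.
have h := product_transport a0 lip.
have hG : avg (fun x => expR (U x)) <=
    avg (fun x => expR (2 * U x - 4 * \sum_j (2 * al x j) ^+ 2)).
  apply: le_avg => x; rewrite ler_expR.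
  have : \sum_j (2 * al x j) ^+ 2 <= \sum_j (4^-1 * al x j).
    by apply: ler_sum => j _; have := al0 x j; have := al1 x j; nra.
  by rewrite -mulr_sumr; have := alU x; lra.
have hM : expR (- (2 * avg U)) <= avg (fun x => expR (- (2 * U x))).
  rewrite -avgZ -mulN1r -avgZ; apply: (le_trans (expR_avg x0 _)).
  by apply: le_avg => e; rewrite mulN1r.
have hh : avg (fun x => expR (U x)) * expR (- (2 * avg U)) <= 1.
  apply: le_trans h; apply: ler_pM => //; last exact: expR_ge0.
  by apply: avg_ge0 => e; exact: expR_ge0.
by move: hh; rewrite expRN ler_pdivrMr ?expR_gt0 // mul1r.
Qed.

Definition avg_sets A (k : nat) (H : {set A} -> R) : R :=
  (\sum_(Z : {set A} | #|Z| == k) H Z) / 'C(#|A|, k)%:R.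

(** Removing [b] is a bijection from pairs with [b] in a set of size [k + 1] to pairs with [b]
    outside a set of size [k]. *)
Lemma sum_sets_remove A k (phi : {set A} -> A -> R) :
  \sum_(Z : {set A} | #|Z| == k.+1) \sum_(b in Z) phi (Z :\ b) b =
  \sum_(Z : {set A} | #|Z| == k) \sum_(b in ~: Z) phi Z b.
Proof.
rewrite (exchange_big_dep xpredT) //= [RHS](exchange_big_dep xpredT) //=.
apply: eq_bigr => b _.
rewrite (reindex_onto (fun Z => b |: Z) (fun Z => Z :\ b)) /=; last first.
  by move=> Z /andP[_ bZ]; rewrite finset.setD1K.
have cond (Z : {set A}) : [&& #|b |: Z| == k.+1, b \in b |: Z & (b |: Z) :\ b == Z]
    = (#|Z| == k) && (b \in ~: Z).
  rewrite finset.setU11 /= inE; have [bZ|bZ] := boolP (b \in Z).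
    rewrite !andbF; apply/negbTE; rewrite negb_and; apply/orP; right.
    by apply/eqP => /finset.setP/(_ b); rewrite !inE eqxx bZ.
  by rewrite finset.setU1K // eqxx cardsU1 bZ add1n eqSS andbT.
by apply: eq_big => [Z|Z]; [rewrite -andbA cond | case/andP => _ /eqP ->].
Qed.

(* Hoeffding's comparison of sampling without and with replacement. *)
Lemma sampling_replacement T (Psi : (T -> R) -> R) A (v : A -> T -> R) k (F : T -> R) :
  subdifferentiable Psi -> (k <= #|A|)%N ->
  avg_sets k (fun Z => Psi (fun t => F t + \sum_(i in Z) v i t)) <=
  avg (fun x : {ffun 'I_k -> A} => Psi (fun t => F t + \sum_j v (x j) t)).
Proof.
move=> sub; have ext := subdiff_ext sub.
elim: k F => [|k IH] F kA.
  have x0 : {ffun 'I_0 -> A} by apply: finfun; case.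
  rewrite (avg_ffun0 _ x0) /avg_sets (big_pred1 finset.set0); last by move=> Z; rewrite cards_eq0.
  rewrite bin0 divr1; apply/le_of_eq/ext => t; by rewrite big_set0 big_ord0.
have /card_gt0P[a0 _] : (0 < #|A|)%N by apply: leq_ltn_trans kA.
rewrite avg_fcons.
(* One point [a] is drawn first, then [k] points without replacement; [a] may or may not be
   repeated. *)
pose Phi (Z : {set A}) a := Psi (fun t => F t + v a t + \sum_(i in Z) v i t).
apply: (@le_trans _ _ (avg (fun a => avg_sets k (Phi^~ a)))); last first.
  apply: le_avg => a; apply: (le_trans (IH (fun t => F t + v a t) (ltnW kA))).
  apply: le_avg => x; apply/le_of_eq/ext => t; rewrite big_ord_recl fcons0 addrA.
  by congr (_ + _); apply: eq_bigr => j _; rewrite fconsS.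
pose P (Z : {set A}) := Psi (fun t => F t + \sum_(i in Z) v i t).
(* If [a] is new, the union is a set of size [k + 1], obtained once for each of its elements. *)
have out : \sum_(Z : {set A} | #|Z| == k) \sum_(a in ~: Z) Phi Z a =
    k.+1%:R * \sum_(Z : {set A} | #|Z| == k.+1) P Z.
  rewrite -sum_sets_remove mulr_sumr; apply: eq_bigr => Z /eqP cZ.
  rewrite (eq_bigr (fun=> P Z)) ?sumr_const ?cZ ?mulr_natl // => b bZ.
  by apply: ext => t; rewrite [in RHS](big_setD1 b bZ) /= addrA.
(* If [a] is repeated, convexity shows that on average [Psi] does not fall below its mean over sets
   of size [k + 1]. *)
have inn : k%:R * (k.+1%:R * \sum_(Z : {set A} | #|Z| == k.+1) P Z) <=
    (#|A| - k)%:R * \sum_(Z : {set A} | #|Z| == k) \sum_(a in Z) Phi Z a.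
  have -> : (#|A| - k)%:R * \sum_(Z : {set A} | #|Z| == k) \sum_(a in Z) Phi Z a =
      \sum_(Z : {set A} | #|Z| == k) \sum_(b in ~: Z) \sum_(a in Z) Phi Z a.
    rewrite mulr_sumr; apply: eq_bigr => Z /eqP cZ.
    by rewrite sumr_const cardsCs finset.setCK cZ mulr_natl.
  rewrite -(sum_sets_remove k (fun Z _ => \sum_(a in Z) Phi Z a)) mulrA mulr_sumr.
  apply: ler_sum => Z /eqP cZ.
  (* Use one subgradient at the full set [Z] for all exchanges of [b] for [a]; the linear terms are
     antisymmetric in [a] and [b] and sum to zero. *)
  have [t [c hc]] := sub (fun t => F t + \sum_(i in Z) v i t); rewrite -/(P Z) in hc.
  have lin b a : b \in Z -> P Z + c * (v a t - v b t) <= Phi (Z :\ b) a.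
    move=> bZ; apply: le_trans (hc _); rewrite lerD2l.
    by rewrite (big_setD1 b bZ) /=; apply: le_of_eq; ring.
  have diag b : b \in Z -> Phi (Z :\ b) b = P Z.
    by move=> bZ; apply: ext => s; rewrite [in RHS](big_setD1 b bZ) /= addrA.
  have : \sum_(b in Z) \sum_(a in Z) (P Z + c * (v a t - v b t)) <=
      \sum_(b in Z) (P Z + \sum_(a in Z :\ b) Phi (Z :\ b) a).
    apply: ler_sum => b bZ.
    apply: (@le_trans _ _ (\sum_(a in Z) Phi (Z :\ b) a)).
      by apply: ler_sum => a _; exact: lin.
    by rewrite (big_setD1 b) //= diag.
  have -> : \sum_(b in Z) \sum_(a in Z) (P Z + c * (v a t - v b t)) = k.+1%:R * (k.+1%:R * P Z).
    under eq_bigr => b _ do rewrite big_split /= -mulr_sumr sumrB !sumr_const cZ.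
    rewrite big_split /= sumr_const cZ -mulr_sumr sumrB sumr_const cZ -sumrMnl subrr mulr0 addr0.
    by rewrite !mulr_natl.
  rewrite big_split /= sumr_const cZ -[P Z *+ _]mulr_natl => h.
  rewrite -(lerD2l (k.+1%:R * P Z)); apply: le_trans h.
  by apply: le_of_eq; rewrite -[k.+1]addn1 natrD; ring.
have swapE : avg (fun a => avg_sets k (Phi^~ a)) =
    (\sum_(Z : {set A} | #|Z| == k) \sum_a Phi Z a) / 'C(#|A|, k)%:R / #|A|%:R.
  rewrite /avg /avg_sets -mulr_suml; congr (_ / _ / _).
  by rewrite exchange_big.
have splitZ : \sum_(Z : {set A} | #|Z| == k) \sum_a Phi Z a =
    \sum_(Z : {set A} | #|Z| == k) \sum_(a in Z) Phi Z a +
    \sum_(Z : {set A} | #|Z| == k) \sum_(a in ~: Z) Phi Z a.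
  rewrite -big_split; apply: eq_bigr => Z _ /=; rewrite (bigID (mem Z)) /=; congr (_ + _).
  by apply: eq_bigl => a; rewrite inE.
rewrite swapE splitZ out (_ : avg_sets k.+1 _ =
  (\sum_(Z : {set A} | #|Z| == k.+1) P Z) / 'C(#|A|, k.+1)%:R) //.
set X := \sum_(Z : {set A} | _) P Z in inn *.
set Y := \sum_(Z : {set A} | _) \sum_(a in Z) Phi Z a in inn *.
have n0 : 0 < #|A|%:R :> R by rewrite ltr0n; apply: leq_ltn_trans kA.
have d0 : 0 < (#|A| - k)%:R :> R by rewrite ltr0n subn_gt0.
have C0 : 0 < 'C(#|A|, k)%:R :> R by rewrite ltr0n bin_gt0 ltnW.
have C1 : 0 < 'C(#|A|, k.+1)%:R :> R by rewrite ltr0n bin_gt0.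
have eC : (#|A| - k)%:R * 'C(#|A|, k)%:R = k.+1%:R * 'C(#|A|, k.+1)%:R :> R.
  by rewrite -!natrM mul_bin_left.
have nE : #|A|%:R = (#|A| - k)%:R + k%:R :> R by rewrite -natrD subnK // ltnW.
have -> : X / 'C(#|A|, k.+1)%:R = k.+1%:R * X / ((#|A| - k)%:R * 'C(#|A|, k)%:R).
  by rewrite eC -mulf_div divff ?mul1r // pnatr_eq0.
rewrite -[leRHS]mulrA -invfM.
rewrite ler_pdivrMr ?mulr_gt0 // mulrAC ler_pdivlMr ?mulr_gt0 //.
have -> : (Y + k.+1%:R * X) * ((#|A| - k)%:R * 'C(#|A|, k)%:R) =
  ((#|A| - k)%:R * Y + (#|A| - k)%:R * (k.+1%:R * X)) * 'C(#|A|, k)%:R by ring.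
have -> : k.+1%:R * X * ('C(#|A|, k)%:R * #|A|%:R) =
  (k%:R * (k.+1%:R * X) + (#|A| - k)%:R * (k.+1%:R * X)) * 'C(#|A|, k)%:R.
  by rewrite nE; ring.
by apply: ler_wpM2r; [exact: ltW | rewrite lerD2r].
Qed.

Section Rademacher.
Variables (T : finType) (t0 : T) (A : finType) (a0 : A) (N : nat) (q : T -> A -> R).

Definition rad_sup (x : {ffun 'I_N -> A}) (e : {ffun 'I_N -> bool}) : R :=
  fmax t0 (fun t => \sum_j sg (e j) * q t (x j)).

(** The conditional Rademacher complexity given the sample points, without absolute values and
    without the factor 1/N. *)
Definition rad (x : {ffun 'I_N -> A}) : R := avg (rad_sup x).

Definition rad_avg : R := avg rad.

(** Coordinates where [x] and [y] differ carry mean-zero terms, so dropping them cannot increase the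
    average; the rest is shared with [y]. *)
Lemma rad_restrict (x y : {ffun 'I_N -> A}) :
  avg (fun e : {ffun 'I_N -> bool} =>
    fmax t0 (fun t => \sum_(j | x j == y j) sg (e j) * q t (x j))) <= rad y.
Proof.
have := avg_coordwise (v := fun j e t => if x j == y j then sg e * q t (x j) else 0)
  (w := fun j e t => sg e * q t (y j)) (subdiff_ext (fmax_subdiff t0)).
move=> /(_ _ (fun=> 0)) h.
apply: (le_trans (le_trans _ (h _))).
- apply: le_of_eq; apply: eq_avg => e; apply: eq_fmax => t.
  by rewrite add0r big_mkcond.
- move=> j F; have [->|_] := eqVneq (x j) (y j); first exact: lexx.
  rewrite (avg_cst true); apply: (le_trans _ (fmax_sg t0 F (fun t => q t (y j)))).
  by apply: le_fmax => t; rewrite addr0.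
- apply: le_of_eq; apply: eq_avg => e; apply: eq_fmax => t.
  by rewrite add0r.
Qed.

Let top (x : {ffun 'I_N -> A}) (e : {ffun 'I_N -> bool}) :=
  [arg max_(t > t0) \sum_j sg (e j) * q t (x j)]%O.

(** The share of coordinate [j] in [rad x], evaluated at the maximizer for each sign vector; these
    shares are the self-bounding coefficients of [rad]. *)
Let beta (x : {ffun 'I_N -> A}) (j : 'I_N) : R :=
  avg (fun e : {ffun 'I_N -> bool} => sg (e j) * q (top x e) (x j)).

Lemma sum_beta x : \sum_j beta x j = rad x.
Proof. by rewrite -avg_sum. Qed.

(** Keeping the maximizer of [x] while dropping the differing coordinates loses exactly their
    shares, and what remains is below [rad y]. *)
Lemma rad_lipschitz x y : rad x - rad y <= \sum_(j | x j != y j) beta x j.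
Proof.
rewrite lerBlDr -lerBlDl; apply: le_trans (rad_restrict x y).
rewrite -avg_sum -avgB; apply: le_avg => e.
apply: (@le_trans _ _ (\sum_(j | x j == y j) sg (e j) * q (top x e) (x j))); last first.
  exact: (fmax_ge t0 (fun t => \sum_(j | x j == y j) sg (e j) * q t (x j))).
rewrite /rad_sup /fmax -/(top x e) lerBlDr.
by rewrite (bigID (fun j => x j == y j)).
Qed.

(** Dropping coordinate [j] does not increase the expected maximum, yet the old maximizer shows that
    the loss is at most [beta x j]. *)
Lemma beta_ge0 x j : 0 <= beta x j.
Proof.
have := avg_coordwise (v := fun i e t => if i != j then sg e * q t (x i) else 0)
  (w := fun j e t => sg e * q t (x j)) (subdiff_ext (fmax_subdiff t0)).
move=> /(_ _ (fun=> 0)) h.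
have {h} hj : avg (fun e : {ffun 'I_N -> bool} =>
    fmax t0 (fun t => \sum_(i | i != j) sg (e i) * q t (x i))) <= rad x.
  apply: (le_trans (le_trans _ (h _))).
  - apply: le_of_eq; apply: eq_avg => e; apply: eq_fmax => t.
    by rewrite add0r big_mkcond.
  - move=> i F; have [_|_] := eqVneq i j; last exact: lexx.
    rewrite /= (avg_cst true); apply: (le_trans _ (fmax_sg t0 F (fun t => q t (x i)))).
    by apply: le_fmax => t; rewrite addr0.
  - by apply: le_of_eq; apply: eq_avg => e; apply: eq_fmax => t; rewrite add0r.
rewrite -subr_ge0 in hj; apply: (le_trans hj).
rewrite /rad -avgB; apply: le_avg => e.
rewrite lerBlDr /rad_sup /fmax -/(top x e) (bigD1 j) //= lerD2l.
exact: (fmax_ge t0 (fun t => \sum_(i | i != j) sg (e i) * q t (x i))).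
Qed.

Lemma beta_le x j (b : R) : (forall t a, `|q t a| <= b) -> beta x j <= b.
Proof.
move=> hq; have e0 : {ffun 'I_N -> bool} by exact: [ffun=> true].
rewrite -[leRHS](avg_cst e0); apply: le_avg => e.
by apply: (le_trans (ler_norm _)); rewrite normr_sgM.
Qed.

Lemma avg_sum_coord (psi : A -> R) :
  avg (fun x : {ffun 'I_N -> A} => \sum_j psi (x j)) = N%:R * avg psi.
Proof.
elim: N => [|n IH].
  have x0 : {ffun 'I_0 -> A} by apply: finfun; case.
  by rewrite (avg_ffun0 _ x0) big_ord0 mul0r.
have x0 : {ffun 'I_n -> A} by exact: [ffun=> a0].
rewrite avg_fcons.
under eq_avg => a do (under eq_avg => x do (rewrite big_ord_recl fcons0;
  under eq_bigr => j _ do rewrite fconsS); rewrite avgD (avg_cst x0) IH).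
by rewrite avgD (avg_cst a0) -[n.+1]addn1 natrD mulrDl mul1r addrC.
Qed.

(** Center the squares, symmetrize, and contract: on [[-b, b]] the map [2 z^2] is Lipschitz with
    constant [4 b]. *)
Lemma avg_sup_sqr (b v : R) : (forall t a, `|q t a| <= b) ->
  (forall t, avg (fun a => q t a ^+ 2) <= v) ->
  avg (fun x : {ffun 'I_N -> A} => fmax t0 (fun t => \sum_j q t (x j) ^+ 2))
  <= N%:R * v + 4 * b * rad_avg.
Proof.
move=> hb hv.
have b0 : 0 <= b by apply: le_trans (hb t0 a0).
have x0 : {ffun 'I_N -> A} by exact: [ffun=> a0].
(* Symmetrization controls mean minus value; the minus sign turns this into the excess of the
   squares over their mean. *)
have sym := symmetrization a0 N (fun t a => - q t a ^+ 2) (fun=> 0) (fmax_subdiff t0).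
apply: (@le_trans _ _ (N%:R * v + avg (fun x : {ffun 'I_N -> A} =>
   fmax t0 (fun t => 0 + \sum_j (avg (fun a => - q t a ^+ 2) - - q t (x j) ^+ 2))))).
  rewrite -[N%:R * v in leRHS](avg_cst x0) -avgD; apply: le_avg => x.
  apply: fmax_le => t; set S := (X in _ + X).
  rewrite -lerBlDl; apply: le_trans (fmax_ge t0 _ t) => /=.
  rewrite add0r sumrB sumr_const card_ord sumrN opprK addrC lerD2r.
  rewrite -[X in _ <= X]mulr_natl -mulrN; apply: ler_wpM2l => //; rewrite lerNl.
  apply: le_trans (hv t); rewrite -mulN1r -avgZ; apply: le_of_eq.
  by apply: eq_avg => a; rewrite mulN1r opprK.
rewrite lerD2l; apply: (le_trans sym).
rewrite -avgZ; apply: le_avg => x; rewrite -avgZ.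
apply: (@le_trans _ _ (avg (fun e : {ffun 'I_N -> bool} =>
    fmax t0 (fun t => 0 + \sum_j sg (e j) * (4 * b * q t (x j)))))).
  apply: rademacher_contraction => j t t'.
  have -> : 2 * - q t (x j) ^+ 2 - 2 * - q t' (x j) ^+ 2 =
     - (2 * (q t (x j) + q t' (x j))) * (q t (x j) - q t' (x j)) by ring.
  rewrite -mulrBr normrM [leRHS]normrM; apply: ler_wpM2r => //.
  rewrite normrN normrM normr_nat [leRHS]ger0_norm ?mulr_ge0 //.
  have := ler_normD (q t (x j)) (q t' (x j)).
  by have := hb t (x j); have := hb t' (x j); lra.
apply: le_avg => e; rewrite /rad_sup -fmaxZ ?mulr_ge0 //.
apply: le_of_eq; apply: eq_fmax => t; rewrite add0r mulr_sumr.
by apply: eq_bigr => j _; ring.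
Qed.

(* Talagrand's inequality for sampling without replacement, with unoptimized constants
   and a multiple of the mean in the exponent. *)
Theorem sampling_mgf (b v lam : R) : (N <= #|A|)%N -> (forall t a, `|q t a| <= b) ->
  (forall t, avg (fun a => q t a ^+ 2) <= v) -> 0 <= lam -> 64 * lam * b <= 1 ->
  avg_sets N (fun Z => expR (lam * fmax t0 (fun t => \sum_(i in Z) (avg (q t) - q t i))))
  <= expR (12 * lam * rad_avg + 128 * lam ^+ 2 * (N%:R * v)).
Proof.
move=> NA hb hv l0 lb.
have b0 : 0 <= b by apply: le_trans (hb t0 a0).
(* The factor 2 is the one produced by symmetrization. *)
have [mu muE] : {mu : R | mu = 2 * lam} by exists (2 * lam).
have mu0 : 0 <= mu by rewrite muE mulr_ge0.
pose V (x : {ffun 'I_N -> A}) : R := fmax t0 (fun t => \sum_j q t (x j) ^+ 2).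
pose U (x : {ffun 'I_N -> A}) : R := 16 * mu ^+ 2 * V x + mu * rad x.
have sub := expR_fmax_subdiff t0 l0.
have rep := sampling_replacement (fun i t => avg (q t) - q t i) (fun=> 0) sub NA.
have sym := symmetrization a0 N q (fun=> 0) sub.
have cond : avg (fun x : {ffun 'I_N -> A} => avg (fun e : {ffun 'I_N -> bool} =>
    expR (lam * fmax t0 (fun t => 0 + \sum_j sg (e j) * (2 * q t (x j)))))) <=
    avg (fun x => expR (U x)).
  apply: le_avg => x; apply: le_trans (rademacher_mgf t0 (fun j t => q t (x j)) mu0).
  apply: le_of_eq; apply: eq_avg => e; congr expR.
  rewrite -!fmaxZ //; apply: eq_fmax => t.
  by rewrite add0r !mulr_sumr; apply: eq_bigr => j _; rewrite muE; ring.
pose tv (x : {ffun 'I_N -> A}) := [arg max_(t > t0) \sum_j q t (x j) ^+ 2]%O.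
(* Both parts of [U] are self-bounding: the maximal sum of squares with the squares at its maximizer
   as coefficients, and [rad] with [beta]. As [mu * b <= 1 / 32], the combined coefficients stay
   below 1/16. *)
have self : avg (fun x => expR (U x)) <= expR (2 * avg U).
  apply: (self_bounding_mgf a0
    (al := fun x j => 16 * mu ^+ 2 * q (tv x) (x j) ^+ 2 + mu * beta x j)).
  - move=> x j; apply: addr_ge0; last by rewrite mulr_ge0 // beta_ge0.
    by apply: mulr_ge0; [apply: mulr_ge0|]; rewrite ?sqr_ge0.
  - move=> x j.
    have h1 : q (tv x) (x j) ^+ 2 <= b ^+ 2.
      by rewrite -[q _ _ ^+ 2]real_normK ?num_real // lerXn2r ?nnegrE.
    have h2 := beta_le x j hb.
    have h3 : 0 <= mu * b by rewrite mulr_ge0.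
    have h4 : mu * b <= 1 / 32 by rewrite muE; lra.
    have h5 : mu * beta x j <= mu * b by rewrite ler_wpM2l.
    have h6 : mu ^+ 2 * q (tv x) (x j) ^+ 2 <= (mu * b) ^+ 2.
      by rewrite exprMn ler_wpM2l ?sqr_ge0.
    by nra.
  - by move=> x; rewrite big_split /= -!mulr_sumr sum_beta.
  move=> x y.
  have hV : V x - V y <= \sum_j q (tv x) (x j) ^+ 2 *+ (x j != y j).
    apply: (@le_trans _ _ (\sum_j (q (tv x) (x j) ^+ 2 - q (tv x) (y j) ^+ 2))).
      rewrite sumrB lerD2l lerN2.
      exact: (fmax_ge t0 (fun t => \sum_j q t (y j) ^+ 2)).
    apply: ler_sum => j _; have [->|_] := eqVneq (x j) (y j); first by rewrite subrr.
    by rewrite mulr1n lerBlDr lerDl sqr_ge0.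
  have hM : rad x - rad y <= \sum_j beta x j *+ (x j != y j).
    apply: (le_trans (rad_lipschitz x y)); rewrite big_mkcond /=.
    by apply: ler_sum => j _; case: (_ != _).
  have -> : U x - U y = 16 * mu ^+ 2 * (V x - V y) + mu * (rad x - rad y) by rewrite /U; ring.
  rewrite (eq_bigr (fun j => 16 * mu ^+ 2 * (q (tv x) (x j) ^+ 2 *+ (x j != y j)) +
    mu * (beta x j *+ (x j != y j)))); last by move=> j _; rewrite mulrnDl !mulrnAr.
  rewrite big_split /= -!mulr_sumr; apply: lerD; apply: ler_wpM2l => //.
  by apply: mulr_ge0 => //; exact: sqr_ge0.
have lhsE : avg_sets N (fun Z => expR (lam * fmax t0 (fun t => \sum_(i in Z) (avg (q t) - q t i))))
   = avg_sets N (fun Z => expR (lam * fmax t0 (fun t => 0 + \sum_(i in Z) (avg (q t) - q t i)))).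
  congr (_ / _); apply: eq_bigr => Z _; congr (expR (_ * _)).
  by apply: eq_fmax => t; rewrite add0r.
rewrite lhsE; apply: (le_trans rep); apply: (le_trans sym).
apply: (le_trans cond); apply: (le_trans self); rewrite ler_expR.
have r0 : 0 <= rad_avg.
  by apply: avg_ge0 => x; rewrite -sum_beta sumr_ge0 // => j _; exact: beta_ge0.
have -> : avg U = 16 * mu ^+ 2 * avg V + mu * rad_avg by rewrite /U avgD !avgZ.
have := avg_sup_sqr hb hv; rewrite -/V => hV.
have : 16 * mu ^+ 2 * avg V <= 16 * mu ^+ 2 * (N%:R * v + 4 * b * rad_avg).
  by apply: ler_wpM2l => //; apply: mulr_ge0 => //; exact: sqr_ge0.
(* This turns the cross term [512 lam^2 b rad_avg] into [8 lam rad_avg]; with the [4 lam rad_avg]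
   already present it gives the constant 12. *)
have : 0 <= (lam * rad_avg) * (1 - 64 * lam * b)
  by apply: mulr_ge0; [exact: mulr_ge0 | rewrite subr_ge0].
by rewrite muE; nra.
Qed.

End Rademacher.

End Concentration.

(** * Spectral decomposition and localized complexity *)

Section RealSpectral.
Variable F : rcfType.

Lemma mulmx_tr_gt0 n (v : 'rV[F]_n) : v != 0 -> 0 < (v *m v^T) 0 0.
Proof.
move=> v0; rewrite mxE lt_neqAle; apply/andP; split.
  rewrite eq_sym; apply: contra v0 => /eqP s0; apply/eqP/rowP => i.
  have h j : xpredT j -> 0 <= v 0 j * v^T j 0 by rewrite mxE -expr2 sqr_ge0.
  have /eqP := psumr_eq0P h s0 (isT : xpredT i).
  by rewrite !mxE mulf_eq0 orbb => /eqP.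
by apply: sumr_ge0 => i _; rewrite mxE -expr2 sqr_ge0.
Qed.

(** The Householder reflection in the hyperplane orthogonal to [v - e]. *)
Lemma reflection_to n (e v : 'rV[F]_n) : e *m e^T = 1%:M -> v *m v^T = 1%:M ->
  exists2 H : 'M[F]_n, H *m H^T = 1%:M & e *m H = v.
Proof.
move=> ee vv; have [->|ne] := eqVneq v e.
  by exists 1%:M; rewrite ?trmx1 mulmx1.
have [w wE] : {w | w = v - e} by exists (v - e).
have w0 : w != 0 by rewrite wE subr_eq0.
pose s := (w *m w^T) 0 0; have s0 : 0 < s := mulmx_tr_gt0 w0.
have ww : w *m w^T = s%:M by rewrite [LHS]mx11_scalar.
pose p := (e *m v^T) 0 0.
have ev : e *m v^T = p%:M by rewrite [LHS]mx11_scalar.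
have ve : v *m e^T = p%:M by rewrite -[LHS]trmxK trmx_mul trmxK ev tr_scalar_mx.
have sE : s = 2 - 2 * p.
  have : w *m w^T = (2 - 2 * p)%:M.
    rewrite wE linearB /= mulmxBl !mulmxBr vv ev ve ee.
    by rewrite -!raddfB /=; congr (_%:M); ring.
  by rewrite ww => /(congr1 (fun M : 'M_1 => M 0 0)); rewrite !mxE.
have ew : e *m w^T = (- (s / 2))%:M.
  rewrite wE linearB /= mulmxBr ev ee -raddfB /=; congr (_%:M).
  by rewrite sE; field.
exists (1%:M - (2 / s) *: (w^T *m w)); last first.
  rewrite mulmxBr mulmx1 -scalemxAr mulmxA ew mul_scalar_mx scalerA.
  have -> : 2 / s * - (s / 2) = -1 by field; rewrite gt_eqF.
  by rewrite scaleN1r opprK wE addrC subrK.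
have -> : (1%:M - (2 / s) *: (w^T *m w))^T = 1%:M - (2 / s) *: (w^T *m w).
  by rewrite linearB /= linearZ /= trmx1 trmx_mul trmxK.
rewrite mulmxBl mul1mx mulmxBr mulmx1.
rewrite -!scalemxAl -!scalemxAr mulmxA -[w^T *m w *m w^T]mulmxA ww mul_mx_scalar.
rewrite -!scalemxAl !scalerA.
have -> : 2 / s * (2 / s * s) = 2 / s + 2 / s by field; rewrite gt_eqF.
by rewrite scalerDl opprB addrK subrK.
Qed.

Lemma char_poly_orth n (A H : 'M[F]_n) : H *m H^T = 1%:M ->
  char_poly (H *m A *m H^T) = char_poly A.
Proof.
move=> HH; rewrite /char_poly.
have -> : char_poly_mx (H *m A *m H^T) =
    map_mx polyC H *m char_poly_mx A *m map_mx polyC H^T.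
  rewrite /char_poly_mx mulmxBr mulmxBl -!map_mxM; congr (_ - _).
  by rewrite mul_mx_scalar -scalemxAl -map_mxM HH map_mx1 scalemx1.
rewrite !det_mulmx mulrAC -det_mulmx -map_mxM HH map_mx1 det1 mul1r //.
Qed.

Lemma char_poly_block n (a : F) (B : 'M[F]_n) :
  char_poly (block_mx a%:M 0 0 B : 'M_(1 + n)) = ('X - a%:P) * char_poly B.
Proof.
rewrite /char_poly /char_poly_mx map_block_mx !raddf0 scalar_mx_block opp_block_mx.
rewrite add_block_mx !oppr0 !addr0 det_lblock; congr (_ * _).
by rewrite map_scalar_mx -raddfB det_scalar1.
Qed.

(** Induction on the dimension: a reflection takes the first basis vector to a unit eigenvector for
    [lam ord0], and symmetry splits off a block. Starting from the factored characteristic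
    polynomial keeps the diagonal in the order of [lam]; the rows of [P] are the eigenvectors. *)
Theorem real_spectral n (A : 'M[F]_n) (lam : 'I_n -> F) : A^T = A ->
  char_poly A = \prod_(i < n) ('X - (lam i)%:P) ->
  exists2 P : 'M[F]_n, P *m P^T = 1%:M & A = P^T *m diag_mx (\row_i lam i) *m P.
Proof.
elim: n A lam => [|n IH] A lam sA cA.
  by exists 1%:M; rewrite ?[LHS]flatmx0 ?[RHS]flatmx0 // flatmx0.
have /eigenvalueP [v vA v0] : eigenvalue A (lam ord0).
  by rewrite eigenvalue_root_char cA big_ord_recl rootE hornerM hornerXsubC subrr mul0r.
pose c := (Num.sqrt ((v *m v^T) 0 0))^-1.
pose v1 := c *: v.
have vv1 : v1 *m v1^T = 1%:M.
  rewrite /v1 linearZ /= -scalemxAl -scalemxAr scalerA [v *m v^T]mx11_scalar.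
  rewrite scale_scalar_mx; congr (_%:M).
  rewrite /c -expr2 exprVn sqr_sqrtr ?mulVf //; last exact/ltW/mulmx_tr_gt0.
  by rewrite gt_eqF // mulmx_tr_gt0.
have vA1 : v1 *m A = lam ord0 *: v1 by rewrite /v1 -scalemxAl vA !scalerA mulrC.
pose e : 'rV[F]_(1 + n) := row_mx 1%:M 0.
have ee : e *m e^T = 1%:M.
  by rewrite /e tr_row_mx mul_row_col trmx1 trmx0 mulmx1 mulmx0 addr0.
have [H HH eH] := reflection_to ee vv1.
pose B : 'M[F]_(1 + n) := H *m A *m H^T.
have sB : B^T = B by rewrite /B !trmx_mul trmxK sA mulmxA.
have eB : e *m B = lam ord0 *: e.
  by rewrite /B !mulmxA eH vA1 -scalemxAl -eH -mulmxA HH mulmx1.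
have topB : usubmx B = row_mx (lam ord0)%:M 0.
  move: eB; rewrite -[in LHS](vsubmxK B) /e mul_row_col mul1mx mul0mx addr0 => ->.
  by rewrite scale_row_mx scaler0 scalemx1.
have BE : B = block_mx (lam ord0)%:M 0 0 (drsubmx B).
  rewrite -[LHS]submxK; congr block_mx.
  - by rewrite /ulsubmx topB row_mxKl.
  - by rewrite /ursubmx topB row_mxKr.
  - by rewrite -[LHS]trmxK trmx_dlsub sB /ursubmx topB row_mxKr trmx0.
have sB' : (drsubmx B)^T = drsubmx B by rewrite trmx_drsub sB.
(* Cancelling the factor of [lam ord0] leaves precisely the remaining list of eigenvalues. *)
have cB : char_poly (drsubmx B) = \prod_(i < n) ('X - (lam (lift ord0 i))%:P).
  have := char_poly_orth A HH; rewrite -/B {1}BE char_poly_block cA big_ord_recl.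
  by move/mulfI; apply; rewrite polyXsubC_eq0.
have [P PP BP] := IH _ _ sB' cB.
have HH' : H^T *m H = 1%:M by apply: mulmx1C.
pose P1 : 'M[F]_(1 + n) := block_mx 1%:M 0 0 P.
have PP1 : P1 *m P1^T = 1%:M.
  rewrite /P1 tr_block_mx mulmx_block.
  by rewrite !trmx0 trmx1 !mulmx0 !mul0mx !addr0 add0r mulmx1 PP -scalar_mx_block.
have BP1 : B = P1^T *m block_mx (lam ord0)%:M 0 0 (diag_mx (\row_i lam (lift ord0 i))) *m P1.
  rewrite BE /P1 tr_block_mx !mulmx_block !trmx0 trmx1 !mulmx0 !mul0mx !addr0 !add0r.
  by rewrite !mul0mx mul1mx mulmx1 -BP.
exists (P1 *m H); first by rewrite trmx_mul mulmxA -[P1 *m H *m H^T]mulmxA HH mulmx1.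
have AB : A = H^T *m B *m H by rewrite /B !mulmxA HH' mul1mx -mulmxA HH' mulmx1.
have -> : diag_mx (\row_i lam i) =
    block_mx (lam ord0)%:M 0 0 (diag_mx (\row_i lam (lift ord0 i))) :> 'M_(1 + n).
  apply/matrixP => i j; rewrite -[i]splitK -[j]splitK.
  case: (split i) => i'; case: (split j) => j' /=.
  - rewrite block_mxEul !mxE !ord1 eqxx; congr (lam _ *+ _); exact: val_inj.
  - by rewrite block_mxEur !mxE -val_eqE /= [i']ord1.
  - by rewrite block_mxEdl !mxE -val_eqE /= [j']ord1.
  - by rewrite block_mxEdr !mxE -val_eqE /= eqSS; congr (lam _ *+ _); exact: val_inj.
by rewrite {1}AB BP1 trmx_mul !mulmxA.
Qed.

End RealSpectral.

Section Complexity.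
Context {R : realType}.
Implicit Types T A : finType.

(** Expanding a nonnegative weighted sum of squares gives the inequality times [X]; [X = 0] is
    separate, since some weights may vanish. *)
Lemma weighted_cauchy_schwarz (I : finType) (P : pred I) (p c w : I -> R) (D : R) :
  (forall i, 0 <= p i) -> 0 <= D -> \sum_(i | P i) p i * c i ^+ 2 <= D ^+ 2 ->
  \sum_(i | P i) p i * c i * w i <= D * Num.sqrt (\sum_(i | P i) p i * w i ^+ 2).
Proof.
move=> p0 D0; set X := \sum_(i | P i) p i * c i ^+ 2 => XD.
set Y := \sum_(i | P i) p i * w i ^+ 2; set S := \sum_(i | P i) _.
have X0 : 0 <= X by rewrite sumr_ge0 // => i _; rewrite mulr_ge0 ?sqr_ge0.
have Y0 : 0 <= Y by rewrite sumr_ge0 // => i _; rewrite mulr_ge0 ?sqr_ge0.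
have SXY : S ^+ 2 <= X * Y.
  have [X00|Xn] := eqVneq X 0.
    have S0 : S = 0.
      apply: big1 => i Pi.
      have h j : P j -> 0 <= p j * c j ^+ 2 by move=> _; rewrite mulr_ge0 ?sqr_ge0.
      have /eqP := psumr_eq0P h X00 Pi.
      by rewrite mulf_eq0 sqrf_eq0 => /orP[] /eqP ->; rewrite ?mulr0 ?mul0r.
    by rewrite S0 X00 mul0r expr0n.
  have Xp : 0 < X by rewrite lt_neqAle eq_sym Xn.
  have : 0 <= \sum_(i | P i) p i * (X * w i - S * c i) ^+ 2.
    by rewrite sumr_ge0 // => i _; rewrite mulr_ge0 ?sqr_ge0.
  have -> : \sum_(i | P i) p i * (X * w i - S * c i) ^+ 2 =
      X ^+ 2 * Y - 2 * X * S * S + S ^+ 2 * X.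
    rewrite (eq_bigr (fun i => X ^+ 2 * (p i * w i ^+ 2) - 2 * X * S * (p i * c i * w i)
      + S ^+ 2 * (p i * c i ^+ 2))); last by move=> i _; ring.
    by rewrite big_split /= sumrB -!mulr_sumr.
  have -> : X ^+ 2 * Y - 2 * X * S * S + S ^+ 2 * X = X * (X * Y - S ^+ 2) by ring.
  by rewrite pmulr_rge0 // subr_ge0.
apply: le_trans (ler_norm _) _; rewrite -sqrtr_sqr.
rewrite -[D]ger0_norm // -sqrtr_sqr -sqrtrM ?sqr_ge0 //.
by rewrite ler_wsqrtr // (le_trans SXY) // ler_wpM2r.
Qed.

Lemma avg_sg_sqr N (c : 'I_N -> R) :
  avg (fun e : {ffun 'I_N -> bool} => (\sum_j sg (e j) * c j) ^+ 2) = \sum_j c j ^+ 2.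
Proof.
elim: N c => [|n IH] c.
  have x0 : {ffun 'I_0 -> bool} by apply: finfun; case.
  by rewrite (avg_ffun0 _ x0) !big_ord0 expr0n.
have e0 : {ffun 'I_n -> bool} by exact: [ffun=> true].
rewrite avg_fcons exchange_avg big_ord_recl -(IH (fun j => c (lift ord0 j))).
rewrite -[c ord0 ^+ 2](avg_cst e0) -avgD; apply: eq_avg => e.
rewrite avg_bool !big_ord_recl !fcons0.
have sumS b : \sum_j sg (fcons b e (lift ord0 j)) * c (lift ord0 j) =
    \sum_j sg (e j) * c (lift ord0 j) by apply: eq_bigr => j _; rewrite fconsS.
by rewrite !sumS; set S := \sum_j _; rewrite /sg expr0 expr1; field.
Qed.

(** The rows of [O] are an orthonormal basis in which [h t] has coordinates [n lam_q c_q], and [D]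
    bounds a kernel norm. Coordinates from [Q] on are controlled by this norm, the first [Q] by the
    penalty. *)
Lemma local_complexity (n N : nat) (O : 'M[R]_n) (lam : 'I_n -> R) T (t0 : T)
    (c h : T -> 'I_n -> R) (D L kap : R) (Q : nat) : (0 < n)%N ->
  O *m O^T = 1%:M -> (forall q, 0 <= lam q) -> 0 <= D -> 0 <= L -> 0 < kap ->
  (forall t, n%:R * \sum_q lam q * c t q ^+ 2 <= D ^+ 2) ->
  (forall t i, h t i = n%:R * \sum_q lam q * c t q * O q i) ->
  avg (fun x : {ffun 'I_N -> 'I_n} => avg (fun e : {ffun 'I_N -> bool} =>
    fmax t0 (fun t => - (kap * avg (fun i => h t i ^+ 2)) + \sum_j sg (e j) * (L * h t (x j)))))
  <= L ^+ 2 * (Q%:R * N%:R) / (4 * kap) + L * D * Num.sqrt (N%:R * \sum_(q < n | (Q <= q)%N) lam q).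
Proof.
move=> n0 OO lam0 D0 L0 kap0 hD hdef; set tail := \sum_(q | _) _.
have i0 : 'I_n := Ordinal n0.
have nR : 0 < n%:R :> R by rewrite ltr0n.
have x0 : {ffun 'I_N -> 'I_n} by exact: [ffun=> i0].
have e0 : {ffun 'I_N -> bool} by exact: [ffun=> true].
pose w (x : {ffun 'I_N -> 'I_n}) (e : {ffun 'I_N -> bool}) q := \sum_j sg (e j) * O q (x j).
pose a t q := n%:R * (lam q * c t q).
have hE t i : h t i = \sum_q a t q * O q i.
  by rewrite hdef mulr_sumr; apply: eq_bigr => q _; rewrite mulrA.
have rowO q q' : \sum_i O q i * O q' i = (q == q')%:R.
  have := congr1 (fun M : 'M_n => M q q') OO; rewrite !mxE => <-.
  by apply: eq_bigr => i _; rewrite mxE.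
have parseval t : n%:R * avg (fun i => h t i ^+ 2) = \sum_q a t q ^+ 2.
  rewrite /avg card_ord mulrC divfK ?gt_eqF //.
  transitivity (\sum_i \sum_q \sum_q' a t q * a t q' * (O q i * O q' i)).
    apply: eq_bigr => i _; rewrite hE expr2 mulr_suml; apply: eq_bigr => q _.
    by rewrite mulr_sumr; apply: eq_bigr => q' _; ring.
  rewrite exchange_big; apply: eq_bigr => q _ /=; rewrite exchange_big /=.
  rewrite (bigD1 q) //= -mulr_sumr rowO eqxx mulr1 big1 ?addr0 ?expr2 // => q' qq'.
  by rewrite -mulr_sumr rowO eq_sym (negbTE qq') mulr0.
have avg_w q : avg (fun x => avg (fun e => w x e q ^+ 2)) = N%:R / n%:R.
  under eq_avg => x do rewrite avg_sg_sqr.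
  rewrite (avg_sum_coord i0 N (fun i => O q i ^+ 2)) /avg card_ord.
  by under eq_bigr do rewrite expr2; rewrite rowO eqxx mul1r.
pose Y x e := \sum_(q < n | (Q <= q)%N) n%:R * lam q * w x e q ^+ 2.
pose W x e := \sum_(q < n | ~~ (Q <= q)%N) w x e q ^+ 2.
have Y0 x e : 0 <= Y x e by apply: sumr_ge0 => q _; rewrite mulr_ge0 ?sqr_ge0 // mulr_ge0.
(* By Parseval's identity the penalty charges [kap / n] per squared coordinate. *)
pose kn := kap / n%:R; have kn0 : 0 < kn by rewrite divr_gt0.
have pointwise (x : {ffun 'I_N -> 'I_n}) (e : {ffun 'I_N -> bool}) :
   fmax t0 (fun t => - (kap * avg (fun i => h t i ^+ 2))
     + \sum_j sg (e j) * (L * h t (x j)))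
   <= L ^+ 2 / (4 * kn) * W x e + L * D * Num.sqrt (Y x e).
  apply: fmax_le => t.
  have -> : \sum_j sg (e j) * (L * h t (x j)) = L * \sum_q a t q * w x e q.
    rewrite mulr_sumr.
    transitivity (\sum_j \sum_q L * (a t q * (sg (e j) * O q (x j)))).
      apply: eq_bigr => j _; rewrite hE !mulr_sumr; apply: eq_bigr => q _; ring.
    by rewrite exchange_big; apply: eq_bigr => q _; rewrite /w !mulr_sumr.
  have -> : kap * avg (fun i => h t i ^+ 2) = kn * \sum_q a t q ^+ 2.
    by rewrite -parseval mulrA divfK ?gt_eqF.
  rewrite [\sum_q a t q * w x e q](bigID (fun q : 'I_n => (Q <= q)%N)) /=.
  rewrite [\sum_q a t q ^+ 2](bigID (fun q : 'I_n => (Q <= q)%N)) /=.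
  have tailb : \sum_(q < n | (Q <= q)%N) a t q * w x e q <= D * Num.sqrt (Y x e).
    rewrite (eq_bigr (fun q => n%:R * lam q * c t q * w x e q)); last first.
      by move=> q _; rewrite /a mulrA.
    apply: weighted_cauchy_schwarz => //; first by move=> q; rewrite mulr_ge0.
    apply: le_trans (hD t); rewrite mulr_sumr [leRHS](bigID (fun q : 'I_n => (Q <= q)%N)) /=.
    under eq_bigr do rewrite -mulrA.
    rewrite lerDl; apply: sumr_ge0 => q _.
    by rewrite mulr_ge0 // mulr_ge0 ?sqr_ge0.
  (* Completing the square coordinate by coordinate. *)
  have topb : L * \sum_(q < n | ~~ (Q <= q)%N) a t q * w x e q <=
      kn * \sum_(q < n | ~~ (Q <= q)%N) a t q ^+ 2 + L ^+ 2 / (4 * kn) * W x e.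
    rewrite !mulr_sumr -big_split /=; apply: ler_sum => q _.
    rewrite -subr_ge0.
    have -> : kn * a t q ^+ 2 + L ^+ 2 / (4 * kn) * w x e q ^+ 2 - L * (a t q * w x e q) =
       kn * (a t q - L * w x e q / (2 * kn)) ^+ 2 by field; rewrite gt_eqF.
    by rewrite mulr_ge0 ?sqr_ge0 // ltW.
  have s0 : 0 <= kn * \sum_(q < n | (Q <= q)%N) a t q ^+ 2.
    by apply: mulr_ge0; [exact: ltW | apply: sumr_ge0 => q _; exact: sqr_ge0].
  have : L * \sum_(q < n | (Q <= q)%N) a t q * w x e q <= L * (D * Num.sqrt (Y x e)).
    exact: ler_wpM2l.
  by rewrite !mulrDr; lra.
apply: (@le_trans _ _ (avg (fun x => avg (fun e =>
   L ^+ 2 / (4 * kn) * W x e + L * D * Num.sqrt (Y x e))))).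
  by apply: le_avg => x; apply: le_avg => e; exact: pointwise.
under eq_avg => x do rewrite avgD !avgZ.
rewrite avgD !avgZ; apply: lerD.
  under eq_avg => x do rewrite avg_sum.
  rewrite avg_sum (eq_bigr (fun=> N%:R / n%:R)) => [|q _]; last exact: avg_w.
  rewrite sumr_const -[_ / _ *+ _]mulr_natr.
  (* When [Q] exceeds [n], all [n] indices are counted. *)
  have cQ : #|[pred q : 'I_n | ~~ (Q <= q)%N]|%:R <= Q%:R :> R.
    rewrite ler_nat -sum1_card (eq_bigl (fun q : 'I_n => (q < Q)%N)); last first.
      by move=> q; rewrite inE -ltnNge.
    case: (leqP Q n) => Qn; first by rewrite -(big_ord_widen n (fun=> 1%N) Qn) sum1_card card_ord.
    by rewrite sum1_card; apply: leq_trans (max_card _) _; rewrite card_ord ltnW.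
  have -> : L ^+ 2 * (Q%:R * N%:R) / (4 * kap) = L ^+ 2 / (4 * kn) * (N%:R / n%:R * Q%:R).
    by rewrite /kn; field; rewrite !gt_eqF.
  apply: ler_wpM2l.
    by apply: divr_ge0; [exact: sqr_ge0 | apply: mulr_ge0 => //; exact: ltW].
  by apply: ler_wpM2l => //; exact: divr_ge0.
apply: ler_wpM2l; first exact: mulr_ge0.
(* Jensen's inequality for the square root, over the signs and then over the points. *)
apply: (@le_trans _ _ (avg (fun x => Num.sqrt (avg (fun e => Y x e))))).
  by apply: le_avg => x; apply: (sqrt_avg e0).
apply: (le_trans (sqrt_avg x0 _)); first by move=> x; apply: avg_ge0 => e; exact: Y0.
apply/ler_wsqrtr/le_of_eq.
under eq_avg => x do rewrite avg_sum.
rewrite avg_sum mulr_sumr; apply: eq_bigr => q _.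
under eq_avg => x do rewrite avgZ.
by rewrite avgZ avg_w; field; rewrite gt_eqF.
Qed.

End Complexity.

(** * Balls of the kernel space *)

Section Minimum.
Import numFieldNormedType.Exports.
Context {R : realType}.

Lemma continuous_sum_fun (V : topologicalType) (I : Type) (r : seq I) (P : pred I)
    (f : I -> V -> R) : (forall i, continuous (f i)) ->
  continuous (fun z => \sum_(i <- r | P i) f i z).
Proof.
move=> cf; elim: r => [|i r IH].
  rewrite (_ : (fun z => _) = (fun=> 0)); first exact: cst_continuous.
  by apply: funext => z; rewrite big_nil.
rewrite (_ : (fun z => _) = (fun z => (if P i then f i z else 0) + \sum_(j <- r | P j) f j z)).
  move=> z; apply: cvgD; last exact: IH.
  by case: (P i); [exact: cf | exact: cvg_cst].
by apply: funext => z; rewrite big_cons; case: (P i); rewrite ?add0r.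
Qed.

Lemma continuous_mul_fun (V : topologicalType) (f g : V -> R) :
  continuous f -> continuous g -> continuous (fun z => f z * g z).
Proof. by move=> cf cg z; apply: cvgM; [exact: cf | exact: cg]. Qed.

Lemma lipschitz_fun_continuous (f : R -> R) (L : R) : 0 <= L ->
  (forall a b, `|f a - f b| <= L * `|a - b|) -> continuous f.
Proof.
move=> L0 lf a; apply/cvgrPdist_lt => e e0.
near=> b; apply: (le_lt_trans (lf a b)).
apply: (@le_lt_trans _ _ ((L + 1) * `|a - b|)); first by rewrite ler_wpM2r // lerDl.
rewrite mulrC -ltr_pdivlMr; last lra.
near: b; apply: (@cvgr_dist_lt _ R^o _ (nbhs a) _ id a); first exact: cvg_id.
by rewrite divr_gt0 //; lra.
Unshelve. all: by end_near.
Qed.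

(** The ball is closed, contains 0 and lies in the cube of half-side [|mu|], so the extreme value
    theorem applies. *)
Lemma ball_min n (f : 'rV[R]_n -> R) (mu : R) : continuous f ->
  exists2 z : 'rV[R]_n, \sum_q z 0 q ^+ 2 <= mu ^+ 2 &
    forall w : 'rV[R]_n, \sum_q w 0 q ^+ 2 <= mu ^+ 2 -> f z <= f w.
Proof.
move=> cf; pose B := [set z : 'rV[R]_n | \sum_q z 0 q ^+ 2 <= mu ^+ 2].
have cN : continuous (fun z : 'rV[R]_n => \sum_q z 0 q ^+ 2).
  apply: continuous_sum_fun => q; under [X in continuous X]funext => z do rewrite expr2.
  by apply: continuous_mul_fun; exact: coord_continuous.
have Bcl : closed B.
  have := @closed_comp _ _ (fun z : 'rV[R]_n => \sum_q z 0 q ^+ 2) [set t | t <= mu ^+ 2].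
  apply; first by move=> z _; exact: cN.
  exact: closed_le.
have cube : compact [set v : 'rV[R]_n | forall i, `[- `|mu|, `|mu|]%classic (v ord0 i)].
  by apply: (@rV_compact _ _ (fun=> `[- `|mu|, `|mu|]%classic)) => _; exact: segment_compact.
have Bc : compact B.
  apply: subclosed_compact Bcl cube _ => z zB i /=.
  rewrite in_itv /= -ler_norml -ler_sqr ?nnegrE // !real_normK ?num_real //.
  apply: le_trans zB; rewrite (bigD1 i) //= lerDl.
  by apply: sumr_ge0 => q _; exact: sqr_ge0.
have B0 : B !=set0.
  by exists 0; rewrite /B /= big1 ?sqr_ge0 // => q _; rewrite mxE expr0n.
have [z zB zmin] := EVT_min_rV B0 Bc (continuous_subspaceT cf).
by exists z; [move: zB; rewrite inE | move=> w wB; apply: zmin; rewrite inE].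
Qed.

End Minimum.

Section Kernel.
Import numFieldNormedType.Exports.
Context {R : realType} {X : Type} {K : X -> X -> R} (H : rkhs K).

Lemma rkhs_dot0 h : rkhs_carrier H h -> rkhs_dot H (fun=> 0) h = 0.
Proof.
move=> hh; have := rkhs_dot_linear 1 (rkhs_zero H) (rkhs_zero H) hh.
have -> : (fun t : X => 1 * (fun=> 0 : R) t + (fun=> 0 : R) t) = (fun=> 0).
  by apply: funext => t; rewrite mulr0 addr0.
rewrite mul1r.
by move=> e; apply: (addrI (rkhs_dot H (fun=> 0) h)); rewrite addr0.
Qed.

Lemma kernel_sum_carrier (I : Type) (r : seq I) (x : I -> X) (a : I -> R) :
  rkhs_carrier H (fun t => \sum_(i <- r) a i * K t (x i)).
Proof.
elim: r => [|i r IH].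
  by rewrite (_ : (fun t => _) = (fun=> 0));
    [exact: rkhs_zero | apply: funext => t; rewrite big_nil].
rewrite (_ : (fun t => _) = (fun t => a i * K t (x i) + \sum_(j <- r) a j * K t (x j))).
  exact: rkhs_comb (rkhs_section H (x i)) IH.
by apply: funext => t; rewrite big_cons.
Qed.

Lemma rkhs_dot_kernel_sum (I : Type) (r : seq I) (x : I -> X) (a : I -> R) h :
  rkhs_carrier H h ->
  rkhs_dot H (fun t => \sum_(i <- r) a i * K t (x i)) h = \sum_(i <- r) a i * h (x i).
Proof.
move=> hh; elim: r => [|i r IH].
  rewrite (_ : (fun t => _) = (fun=> 0)) ?rkhs_dot0 ?big_nil //.
  by apply: funext => t; rewrite big_nil.
rewrite (_ : (fun t => _) = (fun t => a i * K t (x i) + \sum_(j <- r) a j * K t (x j))).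
  have cx := rkhs_section H (x i).
  rewrite rkhs_dot_linear ?IH ?big_cons //; last exact: kernel_sum_carrier.
  by rewrite rkhs_dotC // -rkhs_reproducing.
by apply: funext => t; rewrite big_cons.
Qed.

Variables (n : nat) (x : 'I_n -> X) (O : 'M[R]_n) (lam : 'I_n -> R).
Hypothesis OO : O *m O^T = 1%:M.
Hypothesis lam_ge0 : forall q, 0 <= lam q.
Hypothesis KE : forall i j, K (x i) (x j) = n%:R * \sum_q lam q * O q i * O q j.

Lemma kernel_sum_values (a : 'I_n -> R) i :
  \sum_j a j * K (x i) (x j) = n%:R * \sum_q lam q * (\sum_j a j * O q j) * O q i.
Proof.
under eq_bigr => j _ do rewrite KE mulrCA.
rewrite -mulr_sumr; congr (_ * _).
under eq_bigr => j _ do rewrite mulr_sumr.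
rewrite exchange_big; apply: eq_bigr => q _ /=.
by rewrite [RHS]mulrAC [RHS]mulr_sumr; apply: eq_bigr => j _; ring.
Qed.

(** By the reproducing property the squared norm is the Gram quadratic form, here diagonalized by
    [O]. *)
Lemma kernel_sum_norm (a : 'I_n -> R) (f : X -> R) :
  f = (fun t => \sum_i a i * K t (x i)) ->
  rkhs_dot H f f = n%:R * \sum_q lam q * (\sum_j a j * O q j) ^+ 2.
Proof.
move=> ->; rewrite rkhs_dot_kernel_sum; last exact: kernel_sum_carrier.
under eq_bigr => i _ do rewrite kernel_sum_values mulrCA.
rewrite -mulr_sumr; congr (_ * _).
under eq_bigr => i _ do rewrite mulr_sumr.
rewrite exchange_big; apply: eq_bigr => q _ /=.
by rewrite expr2 mulrA [RHS]mulr_sumr; apply: eq_bigr => j _; ring.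
Qed.

Lemma kernel_ball_coef (mu : R) f : 0 <= mu -> kernel_ball H x mu f ->
  exists c : 'I_n -> R, (forall i, f (x i) = n%:R * \sum_q lam q * c q * O q i) /\
    n%:R * \sum_q lam q * c q ^+ 2 <= mu ^+ 2.
Proof.
move=> mu0 [[a fE] fmu]; exists (fun q => \sum_j a j * O q j); split.
  by move=> i; rewrite fE kernel_sum_values.
rewrite -(kernel_sum_norm fE) -[leLHS]sqr_sqrtr; last first.
  by rewrite fE; apply/rkhs_dot_ge0/kernel_sum_carrier.
by rewrite lerXn2r // nnegrE // sqrtr_ge0.
Qed.

(** Converse of [kernel_ball_coef]: orthogonality of [O] lets any eigenbasis coefficients [c] come
    from kernel coefficients, namely [O^T c]. *)
Lemma coef_kernel_ball (mu : R) (c : 'I_n -> R) : 0 <= mu ->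
  n%:R * \sum_q lam q * c q ^+ 2 <= mu ^+ 2 ->
  exists2 f, kernel_ball H x mu f &
    forall i, f (x i) = n%:R * \sum_q lam q * c q * O q i.
Proof.
move=> mu0 cmu.
pose a j := \sum_q c q * O q j.
have aE q : \sum_j a j * O q j = c q.
  under eq_bigr do rewrite mulr_suml.
  rewrite exchange_big /= (eq_bigr (fun q' => c q' * (q' == q)%:R)).
    rewrite (bigD1 q) //= eqxx mulr1 big1 ?addr0 // => q' qq'.
    by rewrite (negbTE qq') mulr0.
  move=> q' _; have := congr1 (fun M : 'M_n => M q' q) OO; rewrite !mxE => <-.
  by rewrite mulr_sumr; apply: eq_bigr => j _; rewrite mxE mulrA.
exists (fun t => \sum_i a i * K t (x i)); last first.
  by move=> i; rewrite kernel_sum_values; under eq_bigr do rewrite aE.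
split; first by exists a.
rewrite /rkhs_norm (kernel_sum_norm erefl).
under eq_bigr do rewrite aE.
by rewrite -[mu]ger0_norm // -sqrtr_sqr ler_wsqrtr.
Qed.

(** The empirical risk depends on the eigenbasis coefficients only, so the problem reduces to a
    continuous function on a Euclidean ball. The general [k] and [S] cover both training and test
    risks. *)
Lemma kernel_ball_min (Y : Type) (y : 'I_n -> Y) (ell : R -> Y -> R) (mu L k : R)
    (S : {set 'I_n}) : 0 <= mu -> 0 <= L ->
  (forall (a b : R) (t : Y), `|ell a t - ell b t| <= L * `|a - b|) ->
  exists f, is_argmin (kernel_ball H x mu) (fun g => k * \sum_(i in S) loss_of ell x y g i) f.
Proof.
move=> mu0 L0 lip.
(* Scaling by [sqrt (n lam_q)] makes the kernel norm Euclidean. *)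
pose s (q : 'I_n) : R := Num.sqrt (n%:R * lam q).
have ss q : s q ^+ 2 = n%:R * lam q by rewrite sqr_sqrtr // mulr_ge0.
pose v (z : 'rV[R]_n) (i : 'I_n) : R := \sum_q s q * z 0 q * O q i.
have cv i : continuous (fun z : 'rV[R]_n => v z i).
  apply: continuous_sum_fun => q; apply: continuous_mul_fun; last exact: cst_continuous.
  by apply: continuous_mul_fun; [exact: cst_continuous | exact: coord_continuous].
pose J (z : 'rV[R]_n) : R := k * \sum_(i in S) ell (v z i) (y i).
have cJ : continuous J.
  apply: continuous_mul_fun; first exact: cst_continuous.
  apply: continuous_sum_fun => i z.
  apply: (@continuous_comp _ _ _ (fun z : 'rV[R]_n => v z i) (fun a => ell a (y i))).
    exact: cv.
  by apply: (lipschitz_fun_continuous L0) => a b; exact: lip.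
have [z zmu zmin] := ball_min mu cJ.
(* If [s q = 0], division returns 0, which is harmless because that coordinate contributes nothing
   to the values. *)
pose c q := z 0 q / s q.
have cs q : n%:R * lam q * c q = s q * z 0 q.
  rewrite -ss /c; have [->|s0] := eqVneq (s q) 0; first by rewrite expr0n !mul0r.
  by field.
have cmu : n%:R * \sum_q lam q * c q ^+ 2 <= mu ^+ 2.
  apply: le_trans zmu; rewrite mulr_sumr; apply: ler_sum => q _.
  rewrite mulrA -ss /c; have [->|s0] := eqVneq (s q) 0.
    by rewrite expr0n mul0r sqr_ge0.
  by apply: le_of_eq; field.
have [f Ff fE] := coef_kernel_ball mu0 cmu.
have JE g w : (forall i, g (x i) = v w i) -> k * \sum_(i in S) loss_of ell x y g i = J w.
  by move=> gw; congr (_ * _); apply: eq_bigr => i _; rewrite /loss_of gw.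
exists f; split=> // g Fg.
have [d [gE dmu]] := kernel_ball_coef mu0 Fg.
rewrite (JE f z); last first.
  by move=> i; rewrite fE mulr_sumr; apply: eq_bigr => q _; rewrite -cs; ring.
pose w : 'rV[R]_n := \row_q (s q * d q).
rewrite (JE g w); last first.
  move=> i; rewrite gE mulr_sumr; apply: eq_bigr => q _.
  by rewrite mxE [s q * (_ * _)]mulrA -expr2 ss; ring.
apply: zmin; apply: le_trans dmu; rewrite mulr_sumr; apply: ler_sum => q _.
by rewrite mxE exprMn ss mulrA.
Qed.

End Kernel.

(** * Uniform deviations *)

Section Deviation.
Context {R : realType}.

Lemma le_avg_sets (A : finType) k (F G : {set A} -> R) :
  (forall Z : {set A}, #|Z| = k -> F Z <= G Z) -> avg_sets k F <= avg_sets k G.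
Proof.
by move=> h; rewrite ler_wpM2r ?invr_ge0 // ler_sum // => Z /eqP; exact: h.
Qed.

Lemma avg_setsD (A : finType) k (F G : {set A} -> R) :
  avg_sets k (fun Z => F Z + G Z) = avg_sets k F + avg_sets k G.
Proof. by rewrite /avg_sets big_split mulrDl. Qed.

Lemma avg_setsZ (A : finType) k (a : R) (F : {set A} -> R) :
  avg_sets k (fun Z => a * F Z) = a * avg_sets k F.
Proof. by rewrite /avg_sets -mulr_sumr mulrA. Qed.

Lemma avg_sets_cst (A : finType) k (a : R) : (k <= #|A|)%N ->
  avg_sets k (fun _ : {set A} => a) = a.
Proof.
move=> kA; rewrite /avg_sets sumr_const -cardsE card_draws -[a *+ _]mulr_natr mulfK //.
by rewrite pnatr_eq0 -lt0n bin_gt0.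
Qed.

Lemma avg_setsC (u m : nat) (F : {set 'I_(u + m)} -> R) :
  avg_sets u (fun Z => F (~: Z)) = avg_sets m F.
Proof.
rewrite /avg_sets (reindex_inj (@finset.setC_inj _)) /=; congr (_ / _).
  apply: eq_big => [Z|Z _]; last by rewrite finset.setCK.
  have := cardsC Z; rewrite card_ord => h.
  by rewrite -(eqn_add2l #|Z|) h [(#|Z| + u)%N]addnC eqn_add2l eq_sym.
by rewrite card_ord -[in RHS]bin_sub ?leq_addl // addnK.
Qed.

Lemma prob_unifE n u (E : pred {set 'I_n}) :
  prob_unif R u E = avg_sets u (fun Z => (E Z)%:R).
Proof.
(* The comprehension in [prob_unif] is a classical set; its cardinality is that of the boolean
   predicate. *)
have cardE (P : pred {set 'I_n}) : #|[set Z : {set 'I_n} | P Z]%classic| = #|P|.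
  by apply: eq_card => Z; apply/idP/idP; rewrite in_setE.
rewrite /prob_unif /avg_sets !cardE -card_draws; congr (_ / _%:R); last first.
  by apply: eq_card => Z; rewrite inE.
rewrite -sum1_card natr_sum big_mkcondr; apply: eq_bigr => Z _.
by case: (E Z).
Qed.

Lemma avg_Lfull n (F : 'I_n -> R) : avg F = Lfull F.
Proof. by rewrite /avg card_ord mulrC. Qed.

(* Makes the exponential moment bound at the exponent 1 / (64 L0 + 512 L^2 / al) yield a
   deviation of at most al * rho. *)
Definition dev_cst (al L0 L D : R) : R :=
  2 / al * (144 * L ^+ 2 / al + 12 * L * D + (64 * L0 + 512 * L ^+ 2 / al)).

Lemma dev_cst_gt0 al L0 L D : 0 < al -> 0 < L0 -> 0 <= L -> 0 <= D -> 0 < dev_cst al L0 L D.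
Proof.
move=> al0 L00 L0' D0; apply: mulr_gt0; first exact: divr_gt0.
have h1 : 0 <= L ^+ 2 / al by apply: divr_ge0; [exact: sqr_ge0 | exact: ltW].
have h2 : 0 <= L * D by exact: mulr_ge0.
have -> : 144 * L ^+ 2 / al + 12 * L * D + (64 * L0 + 512 * L ^+ 2 / al) =
  656 * (L ^+ 2 / al) + 12 * (L * D) + 64 * L0 by field; rewrite gt_eqF.
by lra.
Qed.

(** Chernoff's bound for the class rescaled by [th]. The zero element [t0] keeps the penalized
    maximum nonnegative, and [rho] is chosen so that the moment bound closes. *)
Lemma uniform_deviation (n k : nat) (T : finType) (t0 : T) (g h c : T -> 'I_n -> R)
    (O : 'M[R]_n) (lam : 'I_n -> R) (L0 L D al s : R) (Q : nat) :
  let rho := dev_cst al L0 L D * (Q%:R / k%:R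
     + Num.sqrt ((\sum_(q < n | (Q <= q)%N) lam q) / k%:R) + s / k%:R) in
  (0 < k <= n)%N -> 0 < L0 -> 0 <= L -> 0 <= D -> 0 < al -> 0 < s ->
  O *m O^T = 1%:M -> (forall q, 0 <= lam q) ->
  (forall t i, `|g t i| <= L0) ->
  (forall t t' i, `|g t i - g t' i| <= L * `|h t i - h t' i|) ->
  (forall i, g t0 i = 0) -> (forall i, h t0 i = 0) ->
  (forall t i, h t i = n%:R * \sum_q lam q * c t q * O q i) ->
  (forall t, n%:R * \sum_q lam q * c t q ^+ 2 <= D ^+ 2) ->
  avg_sets k (fun Z : {set 'I_n} => [exists t,
     al * (rho + Tfull (h t)) < Lfull (g t) - k%:R^-1 * \sum_(i in Z) g t i]%:R)
  <= expR (- s).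
Proof.
move=> rho; have rhodef : rho = dev_cst al L0 L D * (Q%:R / k%:R
  + Num.sqrt ((\sum_(q < n | (Q <= q)%N) lam q) / k%:R) + s / k%:R) by [].
clearbody rho => /andP[k0 kn] L00 L0' D0 al0 s0 OO lam0 gb glip g0 h0 hE cD.
set tail := \sum_(q < n | _) _ in rhodef *.
have n0 : (0 < n)%N by apply: leq_trans kn.
have i0 : 'I_n := Ordinal n0.
have kR : 0 < k%:R :> R by rewrite ltr0n.
have tail0 : 0 <= tail by apply: sumr_ge0.
have K0 := dev_cst_gt0 al0 L00 L0' D0.
have rho0 : 0 < rho.
  rewrite rhodef; apply: mulr_gt0 => //; rewrite ltr_wpDl ?divr_gt0 //.
  by rewrite addr_ge0 ?sqrtr_ge0 // divr_ge0.
have TE t : Tfull (h t) = avg (fun i => h t i ^+ 2) by rewrite avg_Lfull.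
have P0 t : 0 <= Tfull (h t) by rewrite TE; apply: avg_ge0 => i; exact: sqr_ge0.
pose th t := rho / (rho + Tfull (h t)).
have den t : 0 < rho + Tfull (h t) by rewrite ltr_pwDl.
have th0 t : 0 <= th t by apply: divr_ge0; exact: ltW.
have th1 t : th t <= 1 by rewrite ler_pdivrMr // mul1r lerDl.
have thP t : th t * Tfull (h t) <= rho.
  rewrite /th mulrAC ler_pdivrMr // ler_pM2l // lerDr; exact: ltW.
pose q t i := th t * g t i.
have qb t i : `|q t i| <= L0.
  rewrite normrM ger0_norm //; apply: le_trans (gb t i).
  by rewrite -[leRHS]mul1r ler_wpM2r.
have gh t i : `|g t i| <= L * `|h t i|.
  by have := glip t t0 i; rewrite g0 h0 !subr0.
have qv t : avg (fun i => q t i ^+ 2) <= L ^+ 2 * rho.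
  apply: (@le_trans _ _ (th t * (L ^+ 2 * Tfull (h t)))); last first.
    by rewrite mulrCA ler_wpM2l ?sqr_ge0.
  rewrite TE -!avgZ; apply: le_avg => i.
  rewrite exprMn expr2 -mulrA; apply: ler_wpM2l => //.
  apply: (@le_trans _ _ (g t i ^+ 2)).
    by rewrite -[leRHS]mul1r ler_wpM2r ?sqr_ge0.
  rewrite -exprMn -[g t i ^+ 2]real_normK ?num_real // -[(L * h t i) ^+ 2]real_normK ?num_real //.
  by rewrite lerXn2r ?nnegrE // normrM (ger0_norm L0').
(* The first summand gives the range required by [sampling_mgf]; the second keeps the variance term
   below a quarter of the threshold [tau]. *)
pose lamb := (64 * L0 + 512 * L ^+ 2 / al)^-1.
have h1 : 0 <= L ^+ 2 / al by apply: divr_ge0; [exact: sqr_ge0 | exact: ltW].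
have lden : 0 < 64 * L0 + 512 * L ^+ 2 / al by rewrite -[512 * _ / _]mulrA; lra.
have lamb0 : 0 < lamb by rewrite invr_gt0.
have lamb1 : 64 * lamb * L0 <= 1.
  rewrite mulrAC ler_pdivrMr // mul1r -[512 * _ / _]mulrA; lra.
have lamb2 : 128 * lamb * L ^+ 2 <= al / 4.
  rewrite mulrAC ler_pdivrMr //.
  have -> : al / 4 * (64 * L0 + 512 * L ^+ 2 / al) = 16 * (al * L0) + 128 * L ^+ 2.
    by field; rewrite gt_eqF.
  by rewrite lerDr mulr_ge0 // mulr_ge0 // ltW.
(* Chosen so that [12 * kap * rho] is a quarter of [tau]. *)
pose kap := al / 48 * k%:R.
have kap0 : 0 < kap by rewrite mulr_gt0 // divr_gt0.
have radb : rad_avg t0 k q <= L ^+ 2 * (Q%:R * k%:R) / (4 * kap)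
    + L * D * Num.sqrt (k%:R * tail) + kap * rho.
  have x0 : {ffun 'I_k -> 'I_n} by exact: [ffun=> i0].
  have e0 : {ffun 'I_k -> bool} by exact: [ffun=> true].
  have := local_complexity k t0 Q n0 OO lam0 D0 L0' kap0 cD hE.
  rewrite -/tail => lc.
  rewrite -lerBlDr; apply: le_trans lc.
  rewrite lerBlDr -[kap * rho](avg_cst x0) -avgD; apply: le_avg => x.
  apply: (@le_trans _ _ (avg (fun e : {ffun 'I_k -> bool} =>
     fmax t0 (fun t => - (kap * avg (fun i => h t i ^+ 2)) + \sum_j sg (e j) * g t (x j)))
     + kap * rho)).
    rewrite -[kap * rho](avg_cst e0) -avgD; apply: le_avg => e.
    (* As [th t] lies in [[0, 1]] and [m >= 0], rescaling costs only the penalty term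
       [kap * th t * Tfull (h t)], which is at most [kap * rho]. *)
    apply: fmax_le => t; set m := fmax _ _.
    have m0 : 0 <= m.
      apply: le_trans (fmax_ge t0 _ t0) => /=.
      rewrite /avg !big1 ?mul0r ?mulr0 ?oppr0 ?addr0 // => i _; first by rewrite g0 mulr0.
      by rewrite h0 expr0n.
    have := fmax_ge t0 (fun t => - (kap * avg (fun i => h t i ^+ 2))
      + \sum_j sg (e j) * g t (x j)) t.
    rewrite -/m -TE; set S := \sum_j _ => mS.
    have -> : \sum_j sg (e j) * q t (x j) = th t * S.
      by rewrite mulr_sumr; apply: eq_bigr => j _; rewrite /q; ring.
    have := thP t; have := th0 t; have := th1 t.
    move: (th t) (Tfull (h t)) mS => z p mS z1 z0 zp.
    have zS : z * S <= z * (m + kap * p) by apply: ler_wpM2l => //; lra.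
    have zm : z * m <= m by rewrite -[leRHS]mul1r ler_wpM2r.
    have kz : kap * (z * p) <= kap * rho by rewrite ler_wpM2l // ltW.
    by apply: (le_trans zS); rewrite mulrDr mulrCA; lra.
  rewrite lerD2r; apply: (rademacher_contraction t0 _ (g := fun j t => g t (x j))
    (h := fun j t => L * h t (x j))) => j t t'.
  by apply: (le_trans (glip t t' _)); rewrite -mulrBr normrM (ger0_norm L0').
have card_n : (k <= #|'I_n|)%N by rewrite card_ord.
have mgf := sampling_mgf t0 i0 card_n qb qv (ltW lamb0) lamb1.
pose tau := k%:R * (al * rho).
(* A violating [t] pushes the rescaled maximum up to [tau], because [al * rho] equals [th t] times
   the threshold for [t]. *)
apply: (@le_trans _ _ (expR (- (lamb * tau)) * avg_sets k (fun Z : {set 'I_n} =>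
    expR (lamb * fmax t0 (fun t => \sum_(i in Z) (avg (q t) - q t i)))))).
  rewrite -avg_setsZ; apply: le_avg_sets => Z cZ.
  case: existsP => [[t bad]|_]; last by rewrite mulr_ge0 ?expR_ge0.
  rewrite -expRD -expR0 ler_expR addrC subr_ge0 ler_pM2l //.
  apply: le_trans (fmax_ge t0 _ t) => /=.
  rewrite sumrB sumr_const cZ -mulr_natl.
  have -> : \sum_(i in Z) q t i = k%:R * (th t * (k%:R^-1 * \sum_(i in Z) g t i)).
    by rewrite -mulr_sumr; field; rewrite gt_eqF.
  have -> : avg (q t) = th t * Lfull (g t) by rewrite avgZ avg_Lfull.
  rewrite -!mulrBr /tau ler_pM2l //.
  have -> : al * rho = th t * (al * (rho + Tfull (h t))) by rewrite /th; field; rewrite gt_eqF.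
  by apply: ler_wpM2l => //; exact: ltW.
apply: (@le_trans _ _ (expR (- (lamb * tau)) *
   expR (12 * lamb * rad_avg t0 k q + 128 * lamb ^+ 2 * (k%:R * (L ^+ 2 * rho))))).
  by apply: ler_wpM2l => //; exact: expR_ge0.
rewrite -expRD ler_expR.
have sqrtE : Num.sqrt (k%:R * tail) = k%:R * Num.sqrt (tail / k%:R).
  rewrite -[LHS](_ : Num.sqrt (k%:R ^+ 2 * (tail / k%:R)) = _).
    by rewrite sqrtrM ?sqr_ge0 // sqrtr_sqr ger0_norm.
  by congr Num.sqrt; field; rewrite gt_eqF.
rewrite sqrtE in radb.
set sq := Num.sqrt (tail / k%:R) in radb rhodef *.
have sq0 : 0 <= sq by exact: sqrtr_ge0.
have radb' : 12 * rad_avg t0 k q <= 144 * (L ^+ 2 / al) * Q%:R + 12 * (L * D) * (k%:R * sq)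
    + al / 4 * (k%:R * rho).
  apply: (@le_trans _ _ (12 * (L ^+ 2 * (Q%:R * k%:R) / (4 * kap)
    + L * D * (k%:R * sq) + kap * rho))).
    by rewrite ler_wpM2l.
  by apply: le_of_eq; rewrite /kap; field; rewrite !gt_eqF.
have rhoE : k%:R * rho * al / 2 =
    (144 * (L ^+ 2 / al) + 12 * (L * D) + lamb^-1) * (Q%:R + k%:R * sq + s).
  by rewrite rhodef /dev_cst /lamb invrK; field; rewrite !gt_eqF.
have key : 144 * (L ^+ 2 / al) * Q%:R + 12 * (L * D) * (k%:R * sq) + s / lamb
    <= k%:R * rho * al / 2.
  rewrite rhoE.
  have LD : 0 <= L * D by exact: mulr_ge0.
  have l0 : 0 <= lamb^-1 by rewrite invr_ge0 ltW.
  have ks : 0 <= k%:R * sq by rewrite mulr_ge0.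
  have Q0 : 0 <= Q%:R :> R by [].
  move: (L ^+ 2 / al) (L * D) lamb^-1 (k%:R * sq) (Q%:R : R) h1 LD l0 ks Q0
    => a b d e f a0 b0 d0 e0 f0.
  rewrite -subr_ge0.
  have -> : (144 * a + 12 * b + d) * (f + e + s) - (144 * a * f + 12 * b * e + s * d) =
    144 * (a * e) + 144 * (a * s) + 12 * (b * f) + 12 * (b * s) + d * f + d * e by ring.
  by rewrite !addr_ge0 // mulr_ge0 // mulr_ge0 // ltW.
have second : 128 * lamb * (k%:R * (L ^+ 2 * rho)) <= al / 4 * (k%:R * rho).
  have -> : 128 * lamb * (k%:R * (L ^+ 2 * rho)) = 128 * lamb * L ^+ 2 * (k%:R * rho) by ring.
  by rewrite ler_wpM2r // mulr_ge0 // ltW.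
(* Two quarters of [tau] absorb the localization and variance terms; by [key] the other half covers
   the complexity and [s / lamb]. *)
have total : 12 * rad_avg t0 k q + 128 * lamb * (k%:R * (L ^+ 2 * rho)) - tau <= - (s / lamb).
  by rewrite /tau; lra.
have -> : - s = lamb * - (s / lamb) by field; rewrite gt_eqF.
apply: le_trans (ler_wpM2l (ltW lamb0) total).
by apply: le_of_eq; ring.
Qed.

End Deviation.

(** * Spectral form of the Gram matrix and the excess risk bound *)

Section Assembly.
Context {R : realType}.

(** The decomposition of the normalized Gram matrix, read entrywise; testing positive
    semidefiniteness on the rows of [O] gives [lam q >= 0]. *)
Lemma kernel_spectral (X : Type) (K : X -> X -> R) n (x : 'I_n -> X) (lam : 'I_n -> R) :
  (0 < n)%N -> pd_kernel K -> sorted_eigenvalues (n%:R^-1 *: gram K x) lam ->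
  exists O : 'M[R]_n, [/\ O *m O^T = 1%:M, forall q, 0 <= lam q &
    forall i j, K (x i) (x j) = n%:R * \sum_q lam q * O q i * O q j].
Proof.
move=> n0 pd [cA _]; have [sG psdG] := pd n x.
have nR : n%:R != 0 :> R by rewrite pnatr_eq0 -lt0n.
have sA : (n%:R^-1 *: gram K x)^T = n%:R^-1 *: gram K x by rewrite linearZ /= sG.
have [O OO AE] := real_spectral sA cA.
have GE : gram K x = n%:R *: (O^T *m diag_mx (\row_i lam i) *m O).
  by rewrite -AE scalerA divff // scale1r.
exists O; split=> // [q|i j]; last first.
  transitivity (gram K x i j); first by rewrite mxE.
  rewrite GE mxE; congr (_ * _); rewrite mul_mx_diag mxE; apply: eq_bigr => q _.
  by rewrite !mxE; ring.
have := psdG (row q O).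
have -> : (row q O *m gram K x *m (row q O)^T) 0 0 = (O *m gram K x *m O^T) q q.
  by rewrite -row_mul mxE [RHS]mxE; apply: eq_bigr => j _; rewrite !mxE.
rewrite GE -scalemxAr -scalemxAl !mulmxA OO mul1mx -mulmxA OO mulmx1 !mxE eqxx mulr1n.
by rewrite pmulr_rge0 // ltr0n.
Qed.

Lemma min_rateP (u m : nat) (lam : 'I_(u + m) -> R) :
  exists Q : nat, min_rate lam = rate lam Q.
Proof.
rewrite /min_rate; apply: (big_ind (fun z => exists Q : nat, z = rate lam Q)).
- by exists 0%N.
- by move=> a b [Qa ->] [Qb ->]; rewrite minEle; case: ifP => _; [exists Qa | exists Qb].
- by move=> Q _; exists Q.
Qed.

Lemma rate_ge (u m k : nat) (lam : 'I_(u + m) -> R) (Q : nat) (s : R) :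
  (0 < u)%N -> (0 < m)%N -> k = u \/ k = m -> (forall q, 0 <= lam q) -> 0 < s ->
  Q%:R / k%:R + Num.sqrt ((\sum_(q < u + m | (Q <= q)%N) lam q) / k%:R) + s / k%:R
  <= rate lam Q + s / (minn u m)%:R.
Proof.
move=> u0 m0 km lam0 s0; rewrite /rate; set tail := \sum_(q < _ | _) _.
have uR : 0 < u%:R :> R by rewrite ltr0n.
have mR : 0 < m%:R :> R by rewrite ltr0n.
have N0 : 0 < (minn u m)%:R :> R by rewrite ltr0n leq_min u0 m0.
apply: lerD; last first.
  rewrite ler_pM2l // lef_pV2 ?posrE //; last by case: km => ->.
  by rewrite ler_nat; case: km => ->; lia.
rewrite mulrDr.
have := sqrtr_ge0 (tail / u%:R); have := sqrtr_ge0 (tail / m%:R).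
have : 0 <= Q%:R / u%:R :> R by exact: divr_ge0.
have : 0 <= Q%:R / m%:R :> R by exact: divr_ge0.
by case: km => ->; lra.
Qed.

End Assembly.

Theorem theoremV2 (R : realType) (K0 B' L0 L mu : R)
    (hK0 : 1 < K0) (hB' : 0 < B') (hL0 : 0 < L0) (hL : 0 <= L)
    (hmu : 0 <= mu) :
  exists2 c5 : R, 0 < c5 &
  forall (d : nat) (X : set 'rV[R]_d) (Y : set R) (u m : nat)
    (x : 'I_(u + m) -> X) (y : 'I_(u + m) -> Y)
    (K : X -> X -> R) (H : rkhs K) (ell : R -> Y -> R)
    (fstar : X -> R) (lam : 'I_(u + m) -> R),
  let F := kernel_ball H x mu in
  let loss := loss_of ell x y in
  (2 <= u)%N -> (2 <= m)%N ->
  pd_kernel K ->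
  (forall f, F f -> forall i, 0 <= loss f i <= L0) ->
  F fstar ->
  Lfull (loss fstar) = inf [set Lfull (loss f) | f in F] ->
  (forall (a b : R) (t : Y), `|ell a t - ell b t| <= L * `|a - b|) ->
  (forall f, F f ->
    Tfull (fun i => f (x i) - fstar (x i))
      <= B' * Lfull (fun i => loss f i - loss fstar i)) ->
  sorted_eigenvalues ((u + m)%:R^-1 *: gram K x) lam ->
  (forall Z : {set 'I_(u + m)}, #|Z| = u ->
     (exists f, is_argmin F (fun g => Ltrain Z (loss g)) f)
     /\ (exists f, is_argmin F (fun g => Ltest Z (loss g)) f))
  /\
  (forall fm fu : {set 'I_(u + m)} -> X -> R,
     (forall Z : {set 'I_(u + m)}, #|Z| = u ->
        is_argmin F (fun g => Ltrain Z (loss g)) (fm Z)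
        /\ is_argmin F (fun g => Ltest Z (loss g)) (fu Z)) ->
     forall s : R, 0 < s ->
       1 - 3 * expR (- s) <=
       prob_unif R u (fun Z : {set 'I_(u + m)} =>
         excess_risk ell x y Z (fu Z) (fm Z)
           <= c5 * (min_rate lam + s / (minn u m)%:R))).
Proof.
(* With this [al], the variance hypothesis makes [al * Tfull] at most half the mean excess loss. *)
pose al := (2 * B')^-1; have al0 : 0 < al by rewrite invr_gt0 mulr_gt0.
have D0 : 0 <= 2 * mu by rewrite mulr_ge0.
pose C := dev_cst al L0 L (2 * mu); have C0 : 0 < C by exact: dev_cst_gt0.
(* Four units bound the test average for [fm], one unit that for [fu]. *)
exists (5 * (al * C)); first by apply: mulr_gt0 => //; exact: mulr_gt0.
move=> d X Y u m x y K H ell fstar lam F loss u2 m2 pd lossb Fstar _ lip bern eig.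
have u0 : (0 < u)%N by exact: ltn_trans u2.
have m0 : (0 < m)%N by exact: ltn_trans m2.
have n0 : (0 < u + m)%N by rewrite addn_gt0 u0.
have [O [OO lam0 KE]] := kernel_spectral n0 pd eig.
split.
  move=> Z _; split.
    exact: (kernel_ball_min H OO lam0 KE y m%:R^-1 (~: Z) hmu hL lip).
  exact: (kernel_ball_min H OO lam0 KE y u%:R^-1 Z hmu hL lip).
move=> fm fu fmu s s0.
(* A finite index for all functions involved: [None] is [fstar], and the boolean selects [fm Z] or
   [fu Z]. Sets of the wrong size default to [fstar], since the selections are unconstrained
   there. *)
pose T := option (bool * {set 'I_(u + m)}).
pose ft (t : T) : X -> R := if t is Some (b, Z) then
  (if #|Z| == u then (if b then fm Z else fu Z) else fstar) else fstar.
have Fft t : F (ft t).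
  case: t => [[b Z]|] //=; case: eqP => // cZ.
  by have [[Fm _] [Fu _]] := fmu Z cZ; case: b.
have [cc ccP] := choice (fun t => kernel_ball_coef KE hmu (Fft t)).
pose t0 : T := None.
pose g (t : T) i := loss (ft t) i - loss fstar i.
pose h (t : T) i := ft t (x i) - fstar (x i).
(* Differences of coefficients represent [h], with the radius doubled to [2 * mu]. *)
pose c (t : T) q := cc t q - cc t0 q.
have hE t i : h t i = (u + m)%:R * \sum_q lam q * c t q * O q i.
  have [e1 _] := ccP t; have [e2 _] := ccP t0.
  rewrite /h e1 -[fstar]/(ft t0) e2 -mulrBr -sumrB; congr (_ * _).
  by apply: eq_bigr => q _; rewrite /c; ring.
have cD t : (u + m)%:R * \sum_q lam q * c t q ^+ 2 <= (2 * mu) ^+ 2.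
  have [_ e1] := ccP t; have [_ e2] := ccP t0.
  have key : \sum_q lam q * c t q ^+ 2 <=
      2 * (\sum_q lam q * cc t q ^+ 2 + \sum_q lam q * cc t0 q ^+ 2).
    rewrite -big_split mulr_sumr; apply: ler_sum => q _ /=; rewrite -subr_ge0.
    rewrite (_ : _ - _ = lam q * (cc t q + cc t0 q) ^+ 2); last by rewrite /c; ring.
    by rewrite mulr_ge0 // sqr_ge0.
  apply: (le_trans (ler_wpM2l (ler0n R (u + m)) key)).
  by rewrite mulrCA mulrDr; lra.
have gb t i : `|g t i| <= L0.
  have /andP[a1 a2] := lossb _ (Fft t) i; have /andP[b1 b2] := lossb _ Fstar i.
  by rewrite ler_norml /g; apply/andP; split; lra.
have glip t t' i : `|g t i - g t' i| <= L * `|h t i - h t' i|.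
  have -> : g t i - g t' i = loss (ft t) i - loss (ft t') i by rewrite /g; ring.
  have -> : h t i - h t' i = ft t (x i) - ft t' (x i) by rewrite /h; ring.
  exact: lip.
have g0 i : g t0 i = 0 by rewrite /g subrr.
have h0 i : h t0 i = 0 by rewrite /h subrr.
have [Q QE] := min_rateP lam; rewrite QE.
pose rho k := C * (Q%:R / k%:R
   + Num.sqrt ((\sum_(q < u + m | (Q <= q)%N) lam q) / k%:R) + s / k%:R).
set B := rate lam Q + _.
have rhoB k : k = u \/ k = m -> rho k <= C * B.
  by move=> km; apply: ler_wpM2l; [exact: ltW | exact: rate_ge].
pose bad k (g' : T -> 'I_(u + m) -> R) (Z : {set 'I_(u + m)}) :=
  [exists t, al * (rho k + Tfull (h t)) < Lfull (g' t) - k%:R^-1 * \sum_(i in Z) g' t i].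
have bad_le k g' : (0 < k <= u + m)%N -> (g' = g \/ g' = (fun t i => - g t i)) ->
    avg_sets k (fun Z => (bad k g' Z)%:R) <= expR (- s).
  move=> hk gg.
  apply: (@uniform_deviation R (u + m) k _ t0 g' h c O lam L0 L (2 * mu) al s Q
    hk hL0 hL D0 al0 s0 OO lam0 _ _ _ h0 hE cD).
  - by move=> t i; case: gg => ->; rewrite ?normrN.
  - by move=> t t' i; case: gg => ->; [exact: glip | rewrite -opprD normrN; exact: glip].
  - by move=> i; case: gg => ->; rewrite g0 ?oppr0.
(* Three deviation events are excluded: the training set with [g], and the test set with [g] and
   with [- g]. *)
have good (Z : {set 'I_(u + m)}) : #|Z| = u -> ~~ bad m g (~: Z) -> ~~ bad u g Z ->
    ~~ bad u (fun t i => - g t i) Z ->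
    excess_risk ell x y Z (fu Z) (fm Z) <= 5 * (al * C) * B.
  move=> cZ /existsPn b1 /existsPn b2 /existsPn b3.
  pose tm : T := Some (true, Z); pose tu : T := Some (false, Z).
  have ftm : ft tm = fm Z by rewrite /= cZ eqxx.
  have ftu : ft tu = fu Z by rewrite /= cZ eqxx.
  have half t : al * Tfull (h t) <= Lfull (g t) / 2.
    have := bern _ (Fft t); rewrite -/(h t) -/(g t) => hb.
    apply: (le_trans (ler_wpM2l (ltW al0) hb)).
    by apply: le_of_eq; rewrite /al; field; rewrite gt_eqF.
  have Tge t : 0 <= Tfull (h t).
    by rewrite /Tfull mulr_ge0 ?invr_ge0 // sumr_ge0 // => i _; exact: sqr_ge0.
  have Pg t : 0 <= Lfull (g t).
    have h1 : 0 <= al * Tfull (h t) by rewrite mulr_ge0 // ltW.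
    by have := half t; lra.
  have rm : al * rho m <= al * C * B.
    by rewrite -mulrA; apply: ler_wpM2l; [exact: ltW | apply: rhoB; right].
  have ru : al * rho u <= al * C * B.
    by rewrite -mulrA; apply: ler_wpM2l; [exact: ltW | apply: rhoB; left].
  have [[Fm minm] [Fu minu]] := fmu Z cZ.
  have diff k (S : {set 'I_(u + m)}) t : k%:R^-1 * \sum_(i in S) g t i =
      k%:R^-1 * \sum_(i in S) loss (ft t) i - k%:R^-1 * \sum_(i in S) loss fstar i.
    by rewrite -mulrBr -sumrB.
  have train : m%:R^-1 * \sum_(i in ~: Z) g tm i <= 0.
    by rewrite diff ftm subr_le0; exact: minm Fstar.
  (* Training optimality makes the empirical term nonpositive, and half of [Lfull (g tm)] absorbs
     the [Tfull] term. *)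
  have dev_m : Lfull (g tm) <= 2 * (al * C * B).
    have := b1 tm; rewrite -leNgt mulrDr => h1; have := half tm; lra.
  (* Two units for [Lfull (g tm)], one for its half and one for [al * rho u]. *)
  have dev_um : u%:R^-1 * \sum_(i in Z) g tm i <= 4 * (al * C * B).
    have := b3 tm; rewrite -leNgt mulrDr.
    have -> : Lfull (fun i => - g tm i) = - Lfull (g tm) by rewrite /Lfull sumrN mulrN.
    by rewrite sumrN mulrN opprK => h3; have := half tm; lra.
  have dev_uu : - (al * C * B) <= u%:R^-1 * \sum_(i in Z) g tu i.
    have := b2 tu; rewrite -leNgt mulrDr => h2.
    by have := half tu; have := Pg tu; lra.
  have -> : excess_risk ell x y Z (fu Z) (fm Z) =
      u%:R^-1 * \sum_(i in Z) g tm i - u%:R^-1 * \sum_(i in Z) g tu i.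
    by rewrite !diff ftm ftu /excess_risk /Ltest; ring.
  by lra.
rewrite prob_unifE; set E := (X in avg_sets u X).
(* The union bound in pointwise form: at least one of the four indicators equals 1. *)
have total : avg_sets u (fun Z => E Z + ((bad m g (~: Z))%:R + ((bad u g Z)%:R +
    (bad u (fun t i => - g t i) Z)%:R))) >= 1.
  rewrite -[leLHS](@avg_sets_cst _ 'I_(u + m) u); last by rewrite card_ord leq_addr.
  apply: le_avg_sets => Z cZ; have := good Z cZ.
  have E0 : 0 <= E Z by rewrite /E ler0n.
  case: (bad m g _); case: (bad u g Z); case: (bad u _ Z) => /= gZ; try by lra.
  by rewrite /E gZ //= !addr0.
rewrite !avg_setsD (avg_setsC (fun Z => (bad m g Z)%:R)) in total.
have hu : (0 < u <= u + m)%N by rewrite u0 leq_addr.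
have hm : (0 < m <= u + m)%N by rewrite m0 leq_addl.
have e1 := bad_le m g hm (or_introl erefl).
have e2 := bad_le u g hu (or_introl erefl).
have e3 := bad_le u _ hu (or_intror erefl).
by lra.
Qed.
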